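(* Let $X$ be an affine algebraic variety over $k$ with coordinate ring $S$. Consider a collection of pairwise non-intersecting algebraic sets $Y_1,\dots,Y_n$ of $X$, where each ideal $I(Y_i)$ is proper, nonzero, and non-maximal. Then the maximal spectrum of the ring $$R:=\bigcap_i\bigl(k+I(Y_i)\bigr)$$ coincides with $X$ except that each $Y_i$ is identified as a distinct closed point. In particular, the locus $U_{S/R}\subset X$ is given by the intersection of the complements $Y_i^c$, $$U_{S/R}=\bigcap_i Y_i^c .$$ Furthermore, we have: (i) $R$ is nonnoetherian if and only if there is some $i$ for which $\dim Y_i\ge 1$. (ii) $R$ is depicted by $S$ if and only if for each $i$, $\dim Y_i\ge 1$.
   Context: $k$ is an algebraically closed field. $S$ is an integral domain and a finitely generated $k$-algebra, and $X$ is identified with $\operatorname{Max}S$, the set of maximal ideals of $S$. $I(Y_i)$ denotes the radical ideal of $S$ of functions vanishing on the closed set $Y_i$, and $\dim Y_i$ is the Krull dimension of $S/I(Y_i)$. For an ideal $I\subset S$, $k+I$ denotes the subalgebra $\{c+a : c\in k,\ a\in I\}$ of $S$. Complements are taken in $X=\operatorname{Max}S$. For a subalgebra $R\subseteq S$, set $U_{S/R}:=\{\mathfrak n\in\operatorname{Max}S : R_{\mathfrak n\cap R}=S_{\mathfrak n}\}$, the localizations being viewed inside $\operatorname{Frac}S$. $S$ is a depiction of $R$ (equivalently, $R$ is depicted by $S$) if the map $\operatorname{Spec}S\to\operatorname{Spec}R$, $\mathfrak q\mapsto\mathfrak q\cap R$, is surjective, and $U_{S/R}=\{\mathfrak n\in\operatorname{Max}S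 : R_{\mathfrak n\cap R}\text{ is noetherian}\}\neq\emptyset$. *)

(* Defs.v *)
From HB Require Import structures.
From mathcomp Require Import all_boot all_order all_algebra.
From mathcomp Require Import boolp classical_sets.
From mathcomp Require Import mpoly.

Set Implicit Arguments.
Unset Strict Implicit.
Unset Printing Implicit Defensive.

Import GRing.Theory.

Local Open Scope ring_scope.
Local Open Scope classical_set_scope.

(* A subring [A] of a ring [T] and its ideals are both represented as subsets
   of [T], so that for R contained in S a prime q of S contracts to the set
   q `&` R, and S itself is [setT]. *)

Section IdealsOfSubrings.
Variables (T : comNzRingType) (A : set T).

Definition is_ideal (I : set T) : Prop :=
  [/\ I `<=` A,
      I 0,
      (forall x y, I x -> I y -> I (x + y))
    & (forall a x, A a -> I x -> I (a * x))].

Definition prime_ideal (p : set T) : Prop :=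
  [/\ is_ideal p, p <> A
    & forall a b, A a -> A b -> p (a * b) -> p a \/ p b].

Definition maximal_ideal (m : set T) : Prop :=
  [/\ is_ideal m, m <> A
    & forall J, is_ideal J -> m `<=` J -> J = m \/ J = A].

Definition noetherian : Prop :=
  forall I : set T, is_ideal I ->
    exists (d : nat) (g : 'I_d -> T),
      (forall i, I (g i)) /\
      (forall x, I x -> exists c : 'I_d -> T,
         (forall i, A (c i)) /\ x = \sum_(i < d) c i * g i).

Definition MaxSpec : Type := {m : set T | maximal_ideal m}.

Definition zariski_closed (Z : set MaxSpec) : Prop :=
  exists E : set T, is_ideal E /\ Z = [set m : MaxSpec | E `<=` sval m].

End IdealsOfSubrings.

(* The dimension is the supremum of the lengths of the chains
   p_0 < ... < p_d of primes, so dim T >= d means that there is such a chain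
   of length d. *)
Definition krull_dim_geq (T : comNzRingType) (d : nat) : Prop :=
  exists p : nat -> set T,
    (forall i, (i <= d)%N -> prime_ideal setT (p i)) /\
    (forall i, (i < d)%N -> p i `<` p i.+1).

(* The functions vanishing on Y: f vanishes at the point n iff f lies in n. *)
Definition vanishing_ideal (S : comNzRingType) (Y : set (MaxSpec (@setT S))) :
    set S :=
  [set f | forall n, Y n -> sval n f].

Lemma vanishing_ideal_is_ideal (S : comNzRingType)
    (Y : set (MaxSpec (@setT S))) : is_ideal setT (vanishing_ideal Y).
Proof.
split=> //.
- by move=> n _; case: (svalP n) => -[].
- move=> x y Ix Iy n Yn; case: (svalP n) => -[_ _ nD _] _ _.
  by apply: nD; [exact: Ix | exact: Iy].
- move=> a x _ Ix n Yn; case: (svalP n) => -[_ _ _ nM] _ _.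
  by apply: nM => //; exact: Ix.
Qed.

Section CoordinateRing.
Variables (S : comNzRingType) (Y : set (MaxSpec (@setT S))).
Hypothesis Yproper : vanishing_ideal Y <> setT.

(* The unused properness proof in the type makes the canonical ideal structure,
   hence the nonzero ring S / I(Y), available. *)
Definition vanishing_pred of vanishing_ideal Y <> setT : S -> bool :=
  fun f => `[< vanishing_ideal Y f >].

Local Lemma vanishing_pred_idealr : idealr_closed (vanishing_pred Yproper).
Proof.
have [_ I0 ID IM] := vanishing_ideal_is_ideal Y.
split.
- exact/asboolP.
- apply/negP => /asboolP I1; apply: Yproper; apply/seteqP; split=> // x _.
  by rewrite -[x]mulr1; apply: IM.
- move=> a x y /asboolP Ix /asboolP Iy; apply/asboolP.
  by apply: ID => //; apply: IM.
Qed.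

HB.instance Definition _ :=
  isIdealr.Build S (vanishing_pred Yproper) vanishing_pred_idealr.

Definition coord_ring : comNzRingType :=
  {ideal_quot (vanishing_pred Yproper : idealr S)}.

End CoordinateRing.

Definition dim_geq (S : comNzRingType) (Y : set (MaxSpec (@setT S)))
    (Yproper : vanishing_ideal Y <> setT) (d : nat) : Prop :=
  krull_dim_geq (coord_ring Yproper) d.

(* A k-algebra structure on S is a ring morphism [iota] from k to S. *)
Section Algebra.
Variables (k : fieldType) (S : comNzRingType) (iota : {rmorphism k -> S}).

Definition finitely_generated_algebra : Prop :=
  exists (d : nat) (x : 'I_d -> S),
    forall s : S, exists p : {mpoly k[d]}, s = mmap iota x p.

Definition scalars_plus (I : set S) : set S :=
  [set s | exists (c : k) (a : S), I a /\ s = iota c + a].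

End Algebra.

Section Depictions.
Variables (S : idomainType) (R : set S).

(* A_p as a subring of Frac S, for a prime p of a subring A of S. *)
Definition localization (A p : set S) : set {fraction S} :=
  [set x | exists a b : S, [/\ A a, A b, ~ p b & x = tofrac a / tofrac b]].

Definition U_locus : set (MaxSpec (@setT S)) :=
  [set n | localization R (sval n `&` R) = localization setT (sval n)].

Definition depicts : Prop :=
  [/\ (forall p, prime_ideal R p ->
         exists q : set S, prime_ideal setT q /\ q `&` R = p),
      U_locus =
        [set n : MaxSpec (@setT S) |
           noetherian (localization R (sval n `&` R))]
    & U_locus !=set0].

End Depictions.

(* Main.v *)
Require Import Defs.
From mathcomp Require Import all_boot all_order all_algebra.
From mathcomp Require Import boolp classical_sets.
From mathcomp Require Import mpoly ring.

Set Implicit Arguments.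
Unset Strict Implicit.
Unset Printing Implicit Defensive.

Import GRing.Theory.

Local Open Scope ring_scope.
Local Open Scope classical_set_scope.

(** Let [I i] be the ideal of [Y i] and [J] the intersection of the [I i].
    The intersection of the rings [k + I i] is written [glued] below.

    The set [J] is an ideal of both [S] and [glued], so the two rings agree
    wherever some [f] in [J] is nonzero: at a point [x] outside all the [Y
    i] there is such an [f] ([conductor_avoid]), a fraction [a / b] of [S]
    is the fraction [(a * f) / (b * f)] of [glued], and a prime of [glued]
    missing [f] is the contraction of a prime of [S] ([conductor_lift]). On
    [Y i], an element of [glued] is a constant modulo [I i], hence takes a
    single value there: the points of [Y i] have the same contraction
    ([glued_value]). As disjoint closed sets are comaximal, there are
    functions equal to 1 on [Y i] and to 0 on the other [Y j]
    ([partition_of_unity]); they keep the points obtained from distinct [Y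
    i] apart, and they make the localization of [glued] at the image of [Y
    i] depend on [I i] only ([localization_one]). If [x] lies on [Y i], then
    [Y i] has another point [y], because [I i] is not maximal, and the
    inverse of a function vanishing at [y] but not at [x] belongs to the
    local ring of [S] at [x] and not to that of [glued].

    The two criteria hold because, for the local ring of [glued] at the
    image of [Y i], and for [glued] itself with all [i] together, being
    noetherian is equivalent to the finiteness of [S / I i] over [k], that
    is, to [dim (Y i) = 0] ([dim_geq1_codim]). If [S / I i] is not finite
    over [k], take a nonzero [f] in [J]: the ideal [f * S], localized, is
    not finitely generated, since modulo [I i] the ring [glued] only
    contributes scalars ([noetherian_point]). If it is finite, [S] is a
    finite module over [k + I i], and over [glued] if this happens for all
    [i]; noetherianity then descends from [S] ([noetherian_finite_codim]).

    The commutative algebra behind this is Hilbert's basis theorem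
    ([hilbert_basis]) and the Nullstellensatz in the form: a prime [P] and a
    function [f] outside [P] are separated by a point with residue field [k]
    ([nullstellensatz]). With [P] maximal this gives the residue fields of
    [S], with [P = 0] the density of the points. Both are proved one
    variable at a time, on iterated polynomial rings of which [S] is a
    quotient ([polynomial_cover]). *)

(** * Ideals of subrings and noetherian induction *)

Section Ideals.
Variables (T : comNzRingType).

Definition is_subring (A : set T) : Prop :=
  [/\ A 1, forall x y, A x -> A y -> A (x - y)
    & forall x y, A x -> A y -> A (x * y)].

Lemma subring_setT : is_subring setT. Proof. by []. Qed.

Section OneSubring.
Variable A : set T.
Hypothesis hA : is_subring A.

Lemma subring0 : A 0.
Proof. by case: hA => A1 AB _; rewrite -(subrr 1); apply: AB. Qed.

Lemma subringN x : A x -> A (- x).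
Proof.
by case: hA => _ AB _ Ax; rewrite -sub0r; apply: AB => //; exact: subring0.
Qed.

Lemma subringD x y : A x -> A y -> A (x + y).
Proof.
case: hA => _ AB _ Ax Ay; rewrite -[y]opprK.
by apply: AB => //; exact: subringN.
Qed.

Lemma subringM x y : A x -> A y -> A (x * y). Proof. by case: hA => _ _; apply. Qed.

Lemma subring_ideal : is_ideal A A.
Proof. by split=> //; [exact: subring0|exact: subringD|exact: subringM]. Qed.

Section OneIdeal.
Variable I : set T.
Hypothesis hI : is_ideal A I.

Lemma idealS x : I x -> A x. Proof. by case: hI => + _ _ _; apply. Qed.
Lemma ideal0 : I 0. Proof. by case: hI. Qed.
Lemma idealD x y : I x -> I y -> I (x + y). Proof. by case: hI => _ _ + _; apply. Qed.
Lemma idealM a x : A a -> I x -> I (a * x). Proof. by case: hI => _ _ _; apply. Qed.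
Lemma idealMC a x : A a -> I x -> I (x * a). Proof. by rewrite mulrC; exact: idealM. Qed.

Lemma idealN x : I x -> I (- x).
Proof.
move=> Ix; rewrite -mulN1r; apply: idealM => //; apply: subringN.
by case: hA.
Qed.

Lemma idealB x y : I x -> I y -> I (x - y).
Proof. by move=> Ix Iy; apply: idealD => //; exact: idealN. Qed.

Lemma idealBl x y : I (x - y) -> I y -> I x.
Proof. by move=> h Iy; rewrite -(subrK y x); exact: idealD. Qed.

Lemma idealBr x y : I (x - y) -> I x -> I y.
Proof. by move=> h Ix; rewrite -[y](subKr x); exact: idealB. Qed.

Lemma ideal_sum (d : nat) (f : 'I_d -> T) :
  (forall i, I (f i)) -> I (\sum_i f i).
Proof. by move=> If; elim/big_ind: _ => //; [exact: ideal0|exact: idealD]. Qed.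

Lemma ideal_properP : I <> A <-> ~ I 1.
Proof.
split=> [IA I1|I1 IA]; last by apply: I1; rewrite IA; case: hA.
apply: IA; apply/seteqP; split=> [x|x Ax]; first exact: idealS.
by rewrite -[x]mulr1; apply: idealM.
Qed.

Definition add_ideal (a : T) : set T :=
  [set x | exists y c, [/\ I y, A c & x = y + c * a]].

Lemma add_ideal_ideal a : A a -> is_ideal A (add_ideal a).
Proof.
move=> Aa; split.
- move=> _ [y [c [Iy Ac ->]]].
  by apply: subringD; [exact: idealS|exact: subringM].
- by exists 0, 0; split; [exact: ideal0|exact: subring0|rewrite mul0r addr0].
- move=> _ _ [y [c [Iy Ac ->]]] [y' [c' [Iy' Ac' ->]]].
  exists (y + y'), (c + c'); split; [exact: idealD|exact: subringD|].
  by rewrite mulrDl addrACA.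
- move=> b _ Ab [y [c [Iy Ac ->]]].
  exists (b * y), (b * c); split; [exact: idealM|exact: subringM|].
  by rewrite mulrDr mulrA.
Qed.

Lemma sub_add_ideal a : I `<=` add_ideal a.
Proof.
by move=> y Iy; exists y, 0; split=> //; [exact: subring0|rewrite mul0r addr0].
Qed.

Lemma mem_add_ideal a : add_ideal a a.
Proof.
exists 0, 1; split; [exact: ideal0|by case: hA|by rewrite mul1r add0r].
Qed.

End OneIdeal.

Lemma maximal_prime m : maximal_ideal A m -> prime_ideal A m.
Proof.
move=> [hm mA mmax]; split=> // a b Aa Ab mab.
have [//|ma] := pselect (m a); first by left.
right; have [E|E] := mmax _ (add_ideal_ideal hm Aa) (@sub_add_ideal m a).
  by case: ma; rewrite -E; exact: mem_add_ideal.
have : add_ideal m a 1 by rewrite E; case: hA.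
move=> [y [c [my Ac E1]]].
rewrite -[b]mul1r E1 mulrDl; apply: (idealD hm).
  by rewrite mulrC; exact: (idealM hm).
by rewrite -mulrA; exact: (idealM hm).
Qed.

Lemma prime_powN p a n : prime_ideal A p -> A a -> ~ p a -> ~ p (a ^+ n).
Proof.
move=> [hp /(ideal_properP hp) p1 pM] Aa pa; elim: n => [//|n IH].
rewrite exprS => /pM [] // ; elim: n {IH} => [|n IH]; first by case: hA.
by rewrite exprS; exact: subringM.
Qed.

(** Generation is expressed through the ideals containing the generators,
    which replaces every computation with explicit linear combinations by
    the verification that some set is an ideal. *)
Definition fin_gen (I : set T) : Prop := exists s : seq T,
  (forall x, x \in s -> I x) /\
  forall J, is_ideal A J -> (forall x, x \in s -> J x) -> I `<=` J.

Lemma noetherianP : noetherian A <-> forall I, is_ideal A I -> fin_gen I.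
Proof.
split=> [nA I /nA [d [g [Ig gen]]]|nA I /[dup] hI /nA [s [sI gen]]].
  exists (codom g); split=> [x /codomP [i ->]//|J hJ Jg x /gen [c [Ac ->]]].
  apply: (ideal_sum hJ) => i; apply: (idealM hJ) => //.
  by apply: Jg; exact: codom_f.
exists (size s), (fun i : 'I_(size s) => s`_i); split.
  by move=> i; apply: sI; exact: mem_nth.
apply: gen.
  split.
  - move=> _ [c [Ac ->]]; apply: (ideal_sum subring_ideal) => i.
    by apply: subringM => //; apply: (idealS hI); apply: sI; exact: mem_nth.
  - exists (fun=> 0); split; first by move=> _; exact: subring0.
    by rewrite big1 // => i _; rewrite mul0r.
  - move=> _ _ [c [Ac ->]] [c' [Ac' ->]]; exists (fun i => c i + c' i).
    split; first by move=> i; exact: subringD.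
    by rewrite -big_split; apply: eq_bigr => i _; rewrite mulrDl.
  - move=> a _ Aa [c [Ac ->]]; exists (fun i => a * c i).
    split; first by move=> i; exact: subringM.
    by rewrite mulr_sumr; apply: eq_bigr => i _; rewrite mulrA.
move=> x xs; have lt_x : (index x s < size s)%N by rewrite index_mem.
exists (fun i : 'I_(size s) => (i == Ordinal lt_x)%:R); split.
  by move=> i; case: eqP => _; [case: hA|exact: subring0].
rewrite (bigD1 (Ordinal lt_x)) //= eqxx mul1r nth_index // big1 ?addr0 //.
by move=> i /negbTE ->; rewrite mul0r.
Qed.

(** If [P] failed at [I], it would fail at a larger ideal, and again: this
    gives a strictly increasing sequence, whose union would be an ideal
    without a finite set of generators. *)
Lemma noetherian_ind (P : set T -> Prop) : noetherian A ->
  (forall I, is_ideal A I ->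
     (forall J, is_ideal A J -> I `<` J -> P J) -> P I) ->
  forall I, is_ideal A I -> P I.
Proof.
move=> /noetherianP nA IH I0 hI0; apply: contrapT => nP0.
pose bad := [set I | is_ideal A I /\ ~ P I].
have /choice [f fP] : forall I, exists J, bad I -> bad J /\ I `<` J.
  move=> I.
  have [[hI nPI]|nb] := pselect (bad I); last by exists I.
  apply: contrapT => nJ; apply: nPI; apply: IH => // J hJ IJ.
  apply: contrapT => nPJ; apply: nJ; exists J => _; split=> //.
pose F n := iter n f I0.
have Fbad n : bad (F n) by elim: n => [//|n /fP []].
have Flt n : F n `<` F n.+1 by have [] := fP _ (Fbad n).
have Fle m n : (m <= n)%N -> F m `<=` F n.
  elim: n => [|n IHn]; first by rewrite leqn0 => /eqP ->.
  rewrite leq_eqVlt ltnS => /orP [/eqP -> //|/IHn mn].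
  by apply: subset_trans mn _; have [] := Flt n.
have [s [sU gen]] : fin_gen (\bigcup_n F n).
  apply: nA; split.
  - by move=> x [n _ Fx]; exact: (idealS (Fbad n).1).
  - by exists 0%N => //; exact: (ideal0 (Fbad _).1).
  - move=> x y [m _ Fx] [n _ Fy]; exists (maxn m n) => //.
    apply: (idealD (Fbad _).1); [apply: Fle Fx|apply: Fle Fy].
      exact: leq_maxl.
    exact: leq_maxr.
  - by move=> a x Aa [n _ Fx]; exists n => //; exact: (idealM (Fbad _).1).
have [N sN] : exists N, forall x, x \in s -> F N x.
  elim: s sU {gen} => [|y s IHs] sU; first by exists 0%N.
  have [|N FN] := IHs; first by move=> x xs; apply: sU; rewrite inE xs orbT.
  have [|M _ FM] := sU y; first by rewrite inE eqxx.
  exists (maxn M N) => x; rewrite inE => /orP [/eqP ->|/FN].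
    by apply: Fle FM; exact: leq_maxl.
  by apply: Fle; exact: leq_maxr.
have := gen _ (Fbad N).1 sN.
have [le ne] := Flt N; move=> h; apply: ne => x Fx.
by apply: h; exists N.+1.
Qed.

Lemma ex_maximal I : noetherian A -> is_ideal A I -> I <> A ->
  exists2 m, maximal_ideal A m & I `<=` m.
Proof.
move=> nA; move: I.
apply: (noetherian_ind (P := fun I => I <> A ->
  exists2 m, maximal_ideal A m & I `<=` m)) => // I hI IH IA.
have [mI|nmI] := pselect (maximal_ideal A I); first by exists I.
have [J [hJ IJ JA]] : exists J, [/\ is_ideal A J, I `<` J & J <> A].
  apply: contrapT => nJ; apply: nmI; split=> // J hJ IJ.
  apply: contrapT => /not_orP [JI JA]; apply: nJ; exists J; split=> //.
  by split=> // JI'; apply: JI; apply/seteqP.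
have [m mm Jm] := IH _ hJ IJ JA; exists m => //.
by apply: subset_trans Jm; case: IJ.
Qed.

(** The generators of the ideal spanned by [X] can be picked in [X] itself:
    adding elements of [X] one at a time enlarges the ideal they generate,
    and noetherian induction stops this. *)
Lemma noetherian_gen (X : set T) : noetherian A -> X `<=` A ->
  exists s : seq T, (forall x, x \in s -> X x) /\
    forall J, is_ideal A J -> (forall x, x \in s -> J x) -> X `<=` J.
Proof.
move=> nA XA.
pose gen (s : seq T) := [set x | A x /\ forall J, is_ideal A J ->
   (forall y, y \in s -> J y) -> J x].
have hgen s : is_ideal A (gen s).
  split.
  - by move=> x [].
  - by split; [exact: subring0|move=> J hJ _; exact: ideal0 hJ].
  - move=> x y [Ax gx] [Ay gy]; split; first exact: subringD.
    by move=> J hJ sJ; apply: (idealD hJ); [exact: gx|exact: gy].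
  - move=> a x Aa [Ax gx]; split; first exact: subringM.
    by move=> J hJ sJ; apply: (idealM hJ) => //; exact: gx.
have : forall I, is_ideal A I -> forall s : seq T, (forall x, x \in s -> X x) ->
    gen s = I -> exists s : seq T, (forall x, x \in s -> X x) /\
    forall J, is_ideal A J -> (forall x, x \in s -> J x) -> X `<=` J.
  apply: (noetherian_ind nA) => I hI IH s sX EI.
  have [Xs|] := pselect (X `<=` gen s).
    by exists s; split=> // J hJ sJ x /Xs [_]; apply.
  move=> /existsNP [y /not_implyP [Xy nsy]].
  have ysX x : x \in y :: s -> X x by rewrite inE => /orP [/eqP ->|/sX].
  apply: (IH _ (hgen (y :: s)) _ _ ysX erefl).
  rewrite -EI; split.
    move=> x [Ax gx]; split=> // J hJ sJ; apply: gx => // z zs.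
    by apply: sJ; rewrite inE zs orbT.
  move=> /(_ y) sub; apply: nsy; apply: sub; split; first exact: XA.
  by move=> J hJ; apply; rewrite inE eqxx.
by move=> /(_ _ (hgen [::]) [::]); apply.
Qed.

End OneSubring.
End Ideals.

Section Morphisms.
Variables (A B : comNzRingType) (psi : {rmorphism A -> B}).

Lemma preim_prime p : prime_ideal setT p -> prime_ideal setT (psi @^-1` p).
Proof.
move=> [hp /(ideal_properP (@subring_setT B) hp) p1 pM].
have hq : is_ideal setT (psi @^-1` p).
  split=> //=.
  - by rewrite /= rmorph0; exact: ideal0 hp.
  - by move=> x y px py; rewrite /= rmorphD; exact: (idealD hp).
  - by move=> a x _ px; rewrite /= rmorphM; exact: (idealM hp).
split=> //; first by apply/(ideal_properP (@subring_setT A) hq); rewrite /= rmorph1.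
by move=> a b _ _; rewrite /= rmorphM => /pM []; [| |left|right].
Qed.

Lemma noetherian_image : (forall b, exists a, psi a = b) ->
  noetherian (@setT A) -> noetherian (@setT B).
Proof.
move=> surj /(noetherianP (@subring_setT A)) nA.
apply/(noetherianP (@subring_setT B)) => I hI.
have hpre J : is_ideal setT J -> is_ideal setT (psi @^-1` J).
  move=> hJ; split=> //=.
  - by rewrite /= rmorph0; exact: ideal0 hJ.
  - by move=> x y px py; rewrite /= rmorphD; exact: (idealD hJ).
  - by move=> a x _ px; rewrite /= rmorphM; exact: (idealM hJ).
have [s [sI gen]] := nA _ (hpre _ hI).
exists (map psi s); split=> [_ /mapP [x /sI Ix ->]//|J hJ sJ b].
have [a <-] := surj b => /(gen _ (hpre _ hJ)); apply.
by move=> x xs; apply: sJ; exact: map_f.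
Qed.

End Morphisms.

(** * Hilbert's basis theorem *)

Section Hilbert.
Variable A : comNzRingType.

Let sA := @subring_setT A.
Let sP := @subring_setT {poly A}.

(** Bounding the degree by [m], instead of fixing it, puts zero among the
    leading coefficients in degree [m]. *)
Definition lead_ideal (K : set {poly A}) (m : nat) : set A :=
  [set a | exists g, [/\ K g, (size g <= m.+1)%N & g`_m = a]].

Lemma lead_ideal_ideal K m : is_ideal setT K -> is_ideal setT (lead_ideal K m).
Proof.
move=> hK; split=> //.
- by exists 0; split; [exact: ideal0 hK|rewrite size_poly0|rewrite coef0].
- move=> _ _ [g [Kg sg <-]] [h [Kh sh <-]]; exists (g + h).
  split; [exact: (idealD hK)| |by rewrite coefD].
  by apply: leq_trans (size_polyD _ _) _; rewrite geq_max sg.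
- move=> a _ _ [g [Kg sg <-]]; exists (a%:P * g).
  split; [exact: (idealM hK)| |by rewrite coefCM].
  by rewrite mul_polyC; apply: leq_trans (size_scale_leq _ _) sg.
Qed.

Lemma lead_ideal_le K m m' : is_ideal setT K -> (m <= m')%N ->
  lead_ideal K m `<=` lead_ideal K m'.
Proof.
move=> hK le_m _ [g [Kg sg <-]]; exists (g * 'X^(m' - m)).
split; first exact: (idealMC hK).
- have [->|g0] := eqVneq g 0; first by rewrite mul0r size_poly0.
  apply: leq_trans (size_polyMleq _ _) _; rewrite size_polyXn addnS /=.
  by apply: leq_trans (leq_add sg (leqnn _)) _; rewrite addSn subnKC.
- by rewrite coefMXn ltnNge leq_subr /= subKn.
Qed.

(** An element of [I] can be corrected by one of [J] with the same leading
    coefficient, which lowers its degree. *)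
Lemma sub_of_lead_ideals (I J : set {poly A}) :
  is_ideal setT I -> is_ideal setT J ->
  (forall m, lead_ideal I m `<=` lead_ideal (J `&` I) m) -> I `<=` J.
Proof.
move=> hI hJ IJ f; have [m] := ubnP (size f).
elim: m f => [//|m IHm] f; rewrite ltnS => sf If.
case: m sf IHm => [|m] sf IHm.
  by move: sf; rewrite leqn0 size_poly_eq0 => /eqP ->; exact: ideal0 hJ.
have /IJ [g [[Jg Ig] sg Eg]] : lead_ideal I m f`_m by exists f.
apply: (idealBl hJ _ Jg); apply: IHm; last exact: (idealB sP hI).
rewrite ltnS; apply/leq_sizeP => j; rewrite leq_eqVlt => /orP [/eqP <-|lt_mj].
  by rewrite coefB Eg subrr.
by rewrite coefB !nth_default ?subrr //; [apply: leq_trans sg _|apply: leq_trans sf _].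
Qed.

(** The ideals [lead_ideal I m] increase with [m]. Lifts to [I] of
    generators of their union take care of all large degrees, and lifts of
    generators of the finitely many remaining [lead_ideal I m] take care of
    the low ones: an ideal containing all these lifts contains [I] by
    [sub_of_lead_ideals]. *)
Lemma hilbert_basis : noetherian (@setT A) -> noetherian (@setT {poly A}).
Proof.
move=> /(noetherianP sA) nA; apply/(noetherianP sP) => I hI.
have hIJ J : is_ideal setT J -> is_ideal setT (J `&` I).
  move=> hJ; split=> //.
  - by split; [exact: ideal0 hJ|exact: ideal0 hI].
  - by move=> x y [? ?] [? ?]; split; [exact: (idealD hJ)|exact: (idealD hI)].
  - by move=> a x ? [? ?]; split; [exact: (idealM hJ)|exact: (idealM hI)].
(* The predicate L on degrees serves twice: it is trivial for the union of all
   the leading ideals, and singles out one degree for the low ones. *)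
have lift (L : nat -> Prop) (s : seq A) :
    (forall a, a \in s -> exists2 m, L m & lead_ideal I m a) ->
    exists (t : seq {poly A}) (M : nat), (forall g, g \in t -> I g) /\
      forall J, is_ideal setT J -> (forall g, g \in t -> J g) ->
      forall a, a \in s -> exists m, [/\ L m, (m <= M)%N & lead_ideal (J `&` I) m a].
  elim: s => [|a s IHs] Ls; first by exists [::], 0%N.
  have [|t [M [tI tJ]]] := IHs.
    by move=> b bs; apply: Ls; rewrite inE bs orbT.
  have [|m Lm [g [Ig sg Eg]]] := Ls a; first by rewrite inE eqxx.
  exists (g :: t), (maxn m M); split.
    by move=> h; rewrite inE => /orP [/eqP ->|/tI].
  move=> J hJ gtJ b; rewrite inE => /orP [/eqP ->|/(tJ _ hJ)].
    exists m; split=> //; first exact: leq_maxl.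
    by exists g; split=> //; split=> //; apply: gtJ; rewrite inE eqxx.
  move=> [|m' [Lm' le_m' ?]]; first by move=> h ht; apply: gtJ; rewrite inE ht orbT.
  by exists m'; split=> //; apply: leq_trans le_m' _; exact: leq_maxr.
have [s [sL sgen]] : fin_gen setT (\bigcup_m lead_ideal I m).
  apply: nA; split=> //.
  - by exists 0%N => //; exact: (ideal0 (lead_ideal_ideal _ hI)).
  - move=> x y [m _ Lx] [m' _ Ly]; exists (maxn m m') => //.
    apply: (idealD (lead_ideal_ideal _ hI)).
      by apply: (lead_ideal_le hI _ Lx); exact: leq_maxl.
    by apply: (lead_ideal_le hI _ Ly); exact: leq_maxr.
  - by move=> a x _ [m _ Lx]; exists m => //; exact: (idealM (lead_ideal_ideal _ hI)).
have [|t [M [tI tJ]]] := lift (fun=> True) s.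
  by move=> a /sL [m _ ?]; exists m.
have high J : is_ideal setT J -> (forall g, g \in t -> J g) ->
    forall m, (M <= m)%N -> lead_ideal I m `<=` lead_ideal (J `&` I) m.
  move=> hJ gJ m le_m a La.
  apply: (sgen _ (lead_ideal_ideal m (hIJ _ hJ))); last by exists m.
  move=> b /(tJ _ hJ gJ) [m' [_ le_m' Lb]].
  by apply: (lead_ideal_le (hIJ _ hJ) _ Lb); exact: leq_trans le_m' le_m.
have low N : exists u : seq {poly A}, (forall g, g \in u -> I g) /\
    forall J, is_ideal setT J -> (forall g, g \in u -> J g) ->
    forall m, (m < N)%N -> lead_ideal I m `<=` lead_ideal (J `&` I) m.
  elim: N => [|N [u [uI uJ]]]; first by exists [::].
  have [s' [s'L s'gen]] := nA _ (lead_ideal_ideal N hI).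
  have [|v [N' [vI vJ]]] := lift (fun m => m = N) s'.
    by move=> a /s'L ?; exists N.
  exists (u ++ v); split.
    by move=> g; rewrite mem_cat => /orP [/uI|/vI].
  move=> J hJ uvJ m; rewrite ltnS leq_eqVlt => /orP [/eqP ->|lt_m].
    apply: s'gen; first exact: lead_ideal_ideal (hIJ _ hJ).
    move=> a /(vJ _ hJ) []; first by move=> g gv; apply: uvJ; rewrite mem_cat gv orbT.
    by move=> _ [-> _].
  by apply: uJ => // g gu; apply: uvJ; rewrite mem_cat gu.
have [u [uI uJ]] := low M.
exists (t ++ u); split; first by move=> g; rewrite mem_cat => /orP [/tI|/uI].
move=> J hJ tuJ; apply: sub_of_lead_ideals => // m.
have [le_m|lt_m] := leqP M m.
  by apply: high => // g gt; apply: tuJ; rewrite mem_cat gt.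
by apply: uJ => // g gu; apply: tuJ; rewrite mem_cat gu orbT.
Qed.

End Hilbert.

Lemma noetherian_field (k : fieldType) : noetherian (@setT k).
Proof.
have sk := @subring_setT k.
apply/(noetherianP sk) => I hI.
have [[x [Ix x0]]|nI] := pselect (exists x, I x /\ x <> 0).
  exists [:: x]; split=> [y|J hJ Jx y _]; first by rewrite inE => /eqP ->.
  have ux : x != 0 by apply/eqP.
  rewrite -(mulfVK ux y); apply: (idealM hJ) => //.
  by apply: Jx; rewrite inE.
exists [::]; split=> // J hJ _ x Ix.
have [->|x0] := eqVneq x 0; first exact: ideal0 hJ.
by case: nI; exists x; split=> //; apply/eqP.
Qed.

(** * The Nullstellensatz *)

Section Specialization.
Variables (k : closedFieldType) (A : idomainType) (Q : set {poly A}).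
Hypothesis hQ : prime_ideal setT Q.

Let sA := @subring_setT A.
Let sP := @subring_setT {poly A}.
Let iQ : is_ideal setT Q. Proof. by case: hQ. Qed.
Let p : set A := polyC @^-1` Q.
Let hp : prime_ideal setT p.
Proof. exact: (@preim_prime _ _ (polyC : {rmorphism A -> {poly A}})). Qed.
Let ip : is_ideal setT p. Proof. by case: hp. Qed.

Let primeQ f g : Q (f * g) -> Q f \/ Q g.
Proof. by case: hQ => _ _; apply. Qed.

(** These polynomials form the extension of [p] to [{poly A}], which is
    contained in [Q]; the other elements of [Q] are algebraic relations for
    the class of ['X] over [A / p]. *)
Definition coefs_in (g : {poly A}) := forall i, p g`_i.

Lemma coefs_in_mem g : coefs_in g -> Q g.
Proof.
move=> sg; rewrite -[g]coefK poly_def; apply: (ideal_sum iQ) => i.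
by rewrite -mul_polyC; apply: (idealMC iQ) => //; exact: sg.
Qed.

Lemma size_drop_lead (g : {poly A}) : g != 0 ->
  (size (g - lead_coef g *: 'X^((size g).-1))%R < size g)%N.
Proof.
move=> g0; have : (0 < size g)%N by rewrite lt0n size_poly_eq0.
case E: (size g) => [//|n] _ /=; rewrite ltnS.
apply/leq_sizeP => j; rewrite leq_eqVlt => /orP [/eqP <-|lt_j].
  by rewrite coefB coefZ coefXn eqxx mulr1 lead_coefE E subrr.
rewrite coefB coefZ coefXn gtn_eqF // mulr0 subr0 nth_default //.
by rewrite E.
Qed.

Lemma lead_termQ (g : {poly A}) : p (lead_coef g) -> Q (lead_coef g *: 'X^((size g).-1)).
Proof. by move=> pg; rewrite -mul_polyC; apply: (idealMC iQ). Qed.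

(** Leading terms with coefficient in [p] belong to [Q] and can be dropped. *)
Lemma lead_coef_notin (g : {poly A}) : Q g -> ~ coefs_in g ->
  exists h, [/\ Q h, (size h <= size g)%N & ~ p (lead_coef h)].
Proof.
have [n] := ubnP (size g); elim: n g => [//|n IH] g; rewrite ltnS => sg Qg ng.
have [pg|npg] := pselect (p (lead_coef g)); last by exists g.
have g0 : g != 0.
  apply: contra_notN ng => /eqP -> i; rewrite coef0; exact: ideal0 ip.
have lt_s := size_drop_lead g0.
have [| | |h [Qh sh ph]] := IH (g - lead_coef g *: 'X^((size g).-1)).
- exact: leq_trans lt_s sg.
- by apply: (idealB sP iQ) => //; exact: lead_termQ.
- apply: contra_not ng => sm i.
  have := sm i; rewrite coefB coefZ coefXn => h.
  apply: (idealBl ip h); apply: (idealMC ip) => //.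
- by exists h; split=> //; apply: leq_trans sh (ltnW lt_s).
Qed.

(** Let [t] be the class of ['X] in [{poly A} / Q]. If [t] is transcendental
    over [A / p], any [a] equal to a coefficient of [f] outside [p] works,
    since [f] specializes to a nonzero polynomial, which has a nonroot. If
    [t] is algebraic, let [g] be a relation of least degree, with leading
    coefficient outside [p]. Modulo [p], [g] generates [Q] after inverting
    its leading coefficient, so that any root [xi] of its specialization
    kills [Q]. Moreover [f t] is algebraic too, hence has a nonzero multiple
    [r] in [A / p], and [f] cannot vanish at [xi] as long as [r] does not
    specialize to 0. So [a] is the product of [r] and the leading
    coefficient of [g]. Working with congruences modulo [Q] and [p] in
    polynomial rings, rather than with the rings [A / p] and [{poly A} / Q],
    makes the extension of [chi] to [{poly A}] a mere evaluation. *)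
Lemma specialization (f : {poly A}) : ~ Q f ->
  exists a, ~ p a /\ forall chi : {rmorphism A -> k},
    (forall x, p x -> chi x = 0) -> chi a <> 0 ->
    exists xi, (forall g, Q g -> (map_poly chi g).[xi] = 0) /\
               (map_poly chi f).[xi] <> 0.
Proof.
move=> Qf.
have chi_coefs (chi : {rmorphism A -> k}) g : (forall x, p x -> chi x = 0) ->
    coefs_in g -> map_poly chi g = 0.
  by move=> chip sg; apply/polyP => i; rewrite coef_map coef0 /= chip.
have [Qcoefs|] := pselect (forall g, Q g -> coefs_in g).
  have [i npi] : exists i, ~ p f`_i by apply/existsNP => sf; apply/Qf/coefs_in_mem.
  exists f`_i; split=> // chi chip chif.
  have /closed_nonrootP [xi xiP] : map_poly chi f != 0.
    by apply: contra_notN chif => /eqP/polyP/(_ i); rewrite coef_map coef0.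
  exists xi; split; last by apply/eqP.
  by move=> g /Qcoefs sg; rewrite (chi_coefs chi) // horner0.
move=> /existsNP [g1 /not_implyP [Qg1 /(lead_coef_notin Qg1) [g2 [Qg2 _ pg2]]]].
pose cand n := `[< exists g, [/\ Q g, ~ p (lead_coef g) & size g = n] >].
have ex_cand : exists n, cand n by exists (size g2); apply/asboolP; exists g2.
case: (ex_minnP ex_cand) => n /asboolP [g [Qg pg sg]] gmin.
have lowdeg h : Q h -> (size h < size g)%N -> coefs_in h.
  move=> Qh lt_h; apply: contrapT => /(lead_coef_notin Qh) [h' [Qh' sh' ph']].
  have : (n <= size h')%N by apply: gmin; apply/asboolP; exists h'.
  by rewrite -sg leqNgt (leq_ltn_trans sh' lt_h).
have g0 : g != 0.
  by apply: contra_notN pg => /eqP ->; rewrite lead_coef0; exact: ideal0 ip.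
have sg2 : (1 < size g)%N.
  rewrite ltnNge; apply/negP => /size1_polyC Eg; apply: pg.
  by rewrite /p /= Eg lead_coefC -Eg.
pose lc := lead_coef g.
have pow_lc N a : ~ p a -> ~ p (a ^+ N) by exact: (prime_powN sA).
(* The nonzero multiples of f modulo Q; one of least degree is a constant. *)
pose H (h : {poly A}) := ~ Q h /\ exists u, Q (h - u * f).
pose candH n := `[< exists h, H h /\ size h = n >].
have ex_H : exists n, candH n.
  by exists (size f); apply/asboolP; exists f; split=> //; split=> //; exists 1;
     rewrite mul1r subrr; exact: ideal0 iQ.
case: (ex_minnP ex_H) => m /asboolP [h [[nQh [u Qu]] sh]] hmin.
have minH h' : H h' -> (size h <= size h')%N.
  by move=> Hh'; rewrite sh; apply: hmin; apply/asboolP; exists h'.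
have pmul a b : ~ p a -> ~ Q b -> ~ Q (a%:P * b).
  by move=> na nb /primeQ [].
have lt_hg : (size h < size g)%N.
  apply: leq_ltn_trans (ltn_modpN0 f g0); apply: minH.
  have Ef := Pdiv.Idomain.divp_eq f g.
  split.
    move=> Qr; apply: (pmul _ _ (pow_lc (scalp f g) _ pg) Qf).
    by rewrite mul_polyC Ef; apply: (idealD iQ) => //; exact: (idealM iQ).
  exists (lc ^+ scalp f g)%:P; rewrite mul_polyC Ef opprD addrCA subrr addr0.
  by apply: (idealN sP iQ); exact: (idealM iQ).
have h0 : h != 0 by apply: contra_notN nQh => /eqP ->; exact: ideal0 iQ.
have plh : ~ p (lead_coef h).
  move=> plh; have := size_drop_lead h0; rewrite ltnNge => /negP; apply; apply: minH.
  split.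
    by apply: contra_not nQh => Qh; apply: (idealBl iQ Qh); exact: lead_termQ.
  exists u; rewrite addrAC; apply: (idealB sP iQ) => //; exact: lead_termQ.
(* Otherwise the remainder of g by h, again a multiple of f modulo Q, would be 0
   modulo Q by minimality of h, and the quotient of g by h would be a relation
   of degree less than that of g. *)
have sh1 : (size h <= 1)%N.
  rewrite leqNgt; apply/negP => lt1h.
  have Eg := Pdiv.Idomain.divp_eq g h.
  have Qr : Q (g %% h).
    apply: contrapT => nQr; have := ltn_modpN0 g h0; rewrite ltnNge => /negP.
    apply; apply: minH; split=> //; exists (- (g %/ h) * u).
    have -> : g %% h - (- (g %/ h) * u * f) =
        lead_coef h ^+ scalp g h *: g - (g %/ h) * (h - u * f).
      by rewrite Eg mulrBr opprB addrCA addrAC subrr add0r !mulNr opprK mulrA addrC.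
    apply: (idealB sP iQ); last exact: (idealM iQ).
    by rewrite -mul_polyC; exact: (idealM iQ).
  have Sr : coefs_in (g %% h).
    by apply: lowdeg => //; apply: ltn_trans lt_hg; exact: ltn_modpN0.
  have Qq : Q (g %/ h).
    have : Q (g %/ h * h).
      apply: (idealBl iQ (y := - (g %% h))); last exact: (idealN sP iQ).
      by rewrite opprK -Eg -mul_polyC; exact: (idealM iQ).
    by move=> /primeQ [].
  have Sq : coefs_in (g %/ h).
    apply: lowdeg => //; rewrite size_divp //.
    by rewrite ltn_subrL -subn1 subn_gt0 lt1h size_poly_gt0.
  have : ~ p (lead_coef h ^+ scalp g h * lead_coef g).
    move=> H1; case: hp => _ _ pp; case: (pp _ _ _ _ H1) => //.
    exact: pow_lc.
  apply; rewrite -lead_coefZ Eg lead_coefE.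
  rewrite coefD coefM; apply: (idealD ip); last exact: Sr.
  by apply: (ideal_sum ip) => i; exact: (idealMC ip).
have [r Er] : exists r, h = r%:P by exists h`_0; exact: size1_polyC.
have pr : ~ p r by move=> pr; apply: nQh; rewrite Er.
exists (lc * r); split.
  by move=> H1; case: hp => _ _ pp; case: (pp _ _ _ _ H1).
move=> chi chip; rewrite rmorphM /= => /eqP; rewrite mulf_eq0 negb_or => /andP [clc cr].
have sgchi : size (map_poly chi g) = size g by exact: size_map_poly_id0.
have /closed_rootP [xi /rootP gxi] : size (map_poly chi g) != 1%N.
  by rewrite sgchi; case: (size g) sg2 => [|[|]].
have Qxi h' : Q h' -> (map_poly chi h').[xi] = 0.
  move=> Qh'; have Eh := Pdiv.Idomain.divp_eq h' g.
  have Sr : coefs_in (h' %% g).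
    apply: lowdeg; last exact: ltn_modpN0.
    apply: (idealBr sP iQ (x := h' %/ g * g + h' %% g)).
      by rewrite addrK; exact: (idealM iQ).
    by rewrite -Eh -mul_polyC; exact: (idealM iQ).
  have /(congr1 (horner_eval xi \o map_poly chi)) := Eh.
  rewrite /= /horner_eval rmorphD rmorphM /= (chi_coefs _ _ chip Sr) addr0.
  rewrite hornerM gxi mulr0 -mul_polyC rmorphM /= map_polyC hornerM hornerC /=.
  move=> /eqP; rewrite mulf_eq0 rmorphXn expf_eq0 /=.
  by rewrite (negbTE clc) andbF /= => /eqP.
exists xi; split=> // fxi.
have := Qxi _ Qu; rewrite Er rmorphB rmorphM /= map_polyC hornerD hornerN hornerC.
by rewrite hornerM fxi mulr0 subr0 => /eqP; apply/negP.
Qed.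

End Specialization.

Section ScalarResidue.
Variables (k : fieldType) (S : comNzRingType) (iota : {rmorphism k -> S}).
Variables (A : set S).
Hypotheses (hA : is_subring A) (kA : forall c, A (iota c)).

(** The residue ring is [k], a field; the hypothesis says it without forming
    the quotient. *)
Lemma scalar_residue_maximal m : is_ideal A m -> ~ m 1 ->
  (forall s, A s -> exists c, m (s - iota c)) -> maximal_ideal A m.
Proof.
move=> hm m1 residue; split=> //; first exact/(ideal_properP hA hm).
move=> J hJ mJ; have [[s [Js ms]]|nJ] := pselect (exists s, J s /\ ~ m s).
  have [c mc] := residue s (idealS hJ Js).
  have c0 : c != 0.
    by apply: contra_notN ms => /eqP c0; move: mc; rewrite c0 rmorph0 subr0.
  right; apply: contrapT => /(ideal_properP hA hJ); apply.
  rewrite -(rmorph1 iota) -(mulVf c0) rmorphM; apply: (idealM hJ) => //.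
  exact: (idealBr hA hJ (mJ _ mc) Js).
left; apply/seteqP; split=> // s Js; apply: contrapT => ms; apply: nJ.
by exists s.
Qed.

End ScalarResidue.

Section Nullstellensatz.
Variable k : closedFieldType.

(** The Nullstellensatz for a [k]-algebra, stated with [k]-points rather
    than maximal ideals: adding a variable then amounts to extending a
    point. *)
Definition enough_points (A : comNzRingType) (iota : {rmorphism k -> A}) : Prop :=
  forall P f, prime_ideal setT P -> ~ P f ->
  exists chi : {rmorphism A -> k},
    [/\ forall c, chi (iota c) = c, forall x, P x -> chi x = 0 & chi f <> 0].

Lemma enough_points_field : enough_points (idfun : {rmorphism k -> k}).
Proof.
move=> P f [hP /(ideal_properP (@subring_setT k) hP) P1 _] Pf.
exists idfun; split=> // [x Px|f0]; last first.
  by apply: Pf; rewrite (f0 : f = 0); exact: ideal0 hP.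
apply/eqP; apply: contra_notT P1 => x0.
by rewrite -(mulVf x0); exact: (idealM hP).
Qed.

(** [specialization] says that all points of an open subset of the zero set
    of the contraction of [Q] lift to the zero set of [Q], with [f] nonzero. *)
Lemma enough_points_poly (A : idomainType) (iota : {rmorphism k -> A}) :
  enough_points iota ->
  enough_points ((polyC : {rmorphism A -> {poly A}}) \o iota).
Proof.
move=> eA Q f hQ Qf.
have [a [pa spec]] := specialization k hQ Qf.
have [chi [chi_iota chip chia]] :=
  eA _ _ (@preim_prime _ _ (polyC : {rmorphism A -> {poly A}}) _ hQ) pa.
have [xi [Qxi fxi]] := spec chi chip chia.
exists (horner_eval xi \o map_poly chi); split=> //=.
by move=> c; rewrite /horner_eval map_polyC hornerC /= chi_iota.
Qed.

(** [A] is the polynomial ring in [d] variables, built one variable at a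
    time. Only properties inherited by adding a variable are recorded. It is
    an integral domain, as the pseudo-divisions of [specialization] require. *)
Lemma polynomial_cover (S : comNzRingType) (iota : {rmorphism k -> S}) (d : nat)
    (x : 'I_d -> S) :
  exists (A : idomainType) (j : {rmorphism k -> A}) (psi : {rmorphism A -> S}),
    [/\ noetherian (@setT A), enough_points j, forall c, psi (j c) = iota c
      & forall i, exists a, psi a = x i].
Proof.
elim: d x => [|d IHd] x.
  exists k, idfun, iota; split=> //; first exact: noetherian_field.
    exact: enough_points_field.
  by case.
have [A [j [psi [nA eA jE xE]]]] := IHd (x \o lift ord0).
exists {poly A}, ((polyC : {rmorphism A -> {poly A}}) \o j).
exists (horner_eval (x ord0) \o map_poly psi); split.
- exact: hilbert_basis.
- exact: enough_points_poly.
- by move=> c; rewrite /= /horner_eval map_polyC hornerC /= jE.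
- move=> i; case: (unliftP ord0 i) => [i' ->|->]; last first.
    by exists 'X; rewrite /= /horner_eval map_polyX hornerX.
  have [a Ea] := xE i'; exists a%:P.
  by rewrite /= /horner_eval map_polyC hornerC.
Qed.

Section FiniteType.
Variables (S : comNzRingType) (iota : {rmorphism k -> S}).
Hypothesis hS : finitely_generated_algebra iota.

Lemma affine_cover :
  exists (A : idomainType) (j : {rmorphism k -> A}) (psi : {rmorphism A -> S}),
    [/\ noetherian (@setT A), enough_points j, forall c, psi (j c) = iota c
      & forall s, exists a, psi a = s].
Proof.
have [d [x gen]] := hS; have [A [j [psi [nA eA jE xE]]]] := polynomial_cover iota x.
exists A, j, psi; split=> // s; have [p ->] := gen s.
rewrite /mmap.
have sum (I : Type) (r : seq I) (F : I -> S) :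
    (forall i, exists a, psi a = F i) -> exists a, psi a = \sum_(i <- r) F i.
  move=> /choice [g gE]; exists (\sum_(i <- r) g i); rewrite rmorph_sum.
  by apply: eq_bigr => i _.
apply: sum => m; rewrite /mmap1.
have [g gE] := choice xE.
exists (j p@_m * \prod_(i < d) g i ^+ m i); rewrite rmorphM jE rmorph_prod.
by congr (_ * _); apply: eq_bigr => i _; rewrite rmorphXn gE.
Qed.

Lemma affine_noetherian : noetherian (@setT S).
Proof.
by have [A [j [psi [nA _ _ surj]]]] := affine_cover; exact: noetherian_image surj nA.
Qed.

(** The maximal ideal is the kernel of a [k]-point of a polynomial ring
    covering [S]; the point kills the preimage of [P], hence the kernel of
    the cover, and so factors through [S]. *)
Lemma nullstellensatz P f : prime_ideal setT P -> ~ P f ->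
  exists m, [/\ maximal_ideal setT m, P `<=` m, ~ m f
              & forall s, exists c, m (s - iota c)].
Proof.
move=> hP Pf; have [A [j [psi [nA eA jE surj]]]] := affine_cover.
have [f' Ef'] := surj f.
have [|chi [chij chiP chif]] := eA _ f' (@preim_prime _ _ psi _ hP).
  by rewrite /= Ef'.
have chi_psi a b : psi a = psi b -> chi a = chi b.
  move=> E; apply/eqP; rewrite -subr_eq0 -rmorphB; apply/eqP/chiP => /=.
  by rewrite rmorphB E subrr; case: hP => hP' _ _; exact: ideal0 hP'.
pose m : set S := [set s | exists2 a, psi a = s & chi a = 0].
have hm : is_ideal setT m.
  split=> //.
  - by exists 0; rewrite rmorph0.
  - by move=> _ _ [a <- a0] [b <- b0]; exists (a + b); rewrite rmorphD ?a0 ?b0 ?addr0.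
  - move=> s _ _ [a <- a0]; have [b <-] := surj s.
    by exists (b * a); rewrite rmorphM ?a0 ?mulr0.
have mk s : exists c, m (s - iota c).
  have [a <-] := surj s; exists (chi a), (a - j (chi a)).
    by rewrite rmorphB jE.
  by rewrite rmorphB chij subrr.
have m1 : ~ m 1.
  move=> [a E]; rewrite (chi_psi a 1) ?rmorph1 //; apply/eqP; exact: oner_neq0.
exists m; split=> //.
- exact: (scalar_residue_maximal (@subring_setT S) (iota := iota)).
- move=> s Ps; have [a Ea] := surj s; exists a => //.
  by apply: chiP; rewrite /= Ea.
- by move=> [a E a0]; apply: chif; rewrite -(chi_psi a) // Ef'.
Qed.

(** The point given by [nullstellensatz] for the prime [n] itself is [n]. *)
Lemma residue_field n s : maximal_ideal setT n -> exists c, n (s - iota c).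
Proof.
move=> hn; have pn := maximal_prime (@subring_setT S) hn.
have [in_ nT nmax] := hn.
have n1 : ~ n 1 by apply/(ideal_properP (@subring_setT S) in_).
have [m [[hm mT _] nm m1 mk]] := nullstellensatz pn n1.
by have [E|//] := nmax _ hm nm; rewrite -E.
Qed.

End FiniteType.
End Nullstellensatz.

(** * Dimension one and finite codimension *)

(** Primes of a quotient are the primes above the kernel. *)
Lemma krull_dim_geq1 (S T : comNzRingType) (psi : {rmorphism S -> T})
    (I : set S) : (forall t, exists s, psi s = t) ->
  (forall s, psi s = 0 <-> I s) ->
  krull_dim_geq T 1 <-> exists p q,
    [/\ prime_ideal setT p, prime_ideal setT q, I `<=` p & p `<` q].
Proof.
move=> surj kerI; split.
  move=> [p [pp plt]]; exists (psi @^-1` p 0%N), (psi @^-1` p 1%N).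
  have [[pp0 pp1] [lt01 nlt01]] := (pp 0%N isT, pp 1%N isT, plt 0%N isT).
  split; [exact: preim_prime|exact: preim_prime| |].
    by move=> s /kerI E; rewrite /= E; case: pp0 => -[].
  split; first by move=> s; exact: lt01.
  by move=> h; apply: nlt01 => t; have [s <-] := surj t; exact: h.
move=> [p [q [pp pq Ip [pq1 pq2]]]].
have Iq : I `<=` q by exact: subset_trans pq1.
have im_mem r s : prime_ideal setT r -> I `<=` r -> (psi @` r) (psi s) -> r s.
  move=> [hr _ _] Ir [s' rs' E]; apply: (idealBr (@subring_setT S) hr _ rs').
  by apply: Ir; apply/kerI; rewrite rmorphB E subrr.
have im_prime r : prime_ideal setT r -> I `<=` r -> prime_ideal setT (psi @` r).
  move=> pr Ir; have [hr rT rM] := pr.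
  have hpr : is_ideal setT (psi @` r).
    split=> //.
    - by exists 0; [exact: ideal0 hr|rewrite rmorph0].
    - by move=> _ _ [a ra <-] [b rb <-]; exists (a + b);
        [exact: (idealD hr)|rewrite rmorphD].
    - move=> t _ _ [a ra <-]; have [s <-] := surj t.
      by exists (s * a); [exact: (idealM hr)|rewrite rmorphM].
  split=> //.
    apply/(ideal_properP (@subring_setT T) hpr); rewrite -(rmorph1 psi).
    move=> /(im_mem _ _ pr Ir).
    exact/(ideal_properP (@subring_setT S) hr).
  move=> a b _ _; have [s <-] := surj a; have [t <-] := surj b.
  rewrite -rmorphM => /(im_mem _ _ pr Ir) /rM [] // h; [left|right].
    by exists s.
  by exists t.
exists (fun i => if i is 0%N then psi @` p else psi @` q); split.
  by move=> [|i] _; exact: im_prime.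
move=> [|//] _; split; first by move=> _ [s ps <-]; exists s => //; exact: pq1.
move=> h; apply: pq2 => s qs; apply: (im_mem _ _ pp Ip); apply: h.
by exists s.
Qed.

Lemma dim_geq1 (S : comNzRingType) (Y : set (MaxSpec (@setT S)))
    (Yproper : vanishing_ideal Y <> setT) :
  dim_geq Yproper 1 <-> exists p q, [/\ prime_ideal setT p,
    prime_ideal setT q, vanishing_ideal Y `<=` p & p `<` q].
Proof.
pose psi : {rmorphism S -> coord_ring Yproper} :=
  \pi_(coord_ring Yproper)%qT.
apply: (krull_dim_geq1 (psi := psi)).
- by move=> t; exists (repr t); exact: reprK.
- move=> s; rewrite -(rmorph0 psi); split.
    move=> /eqP; rewrite -Quotient.idealrBE subr0 => /asboolP //.
  move=> Is; apply/eqP; rewrite -Quotient.idealrBE subr0; exact/asboolP.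
Qed.

Section FiniteCodimension.
Variables (k : closedFieldType) (S : comNzRingType) (iota : {rmorphism k -> S}).
Let sS := @subring_setT S.

Definition subspace (V : set S) : Prop :=
  [/\ V 0, forall x y, V x -> V y -> V (x + y)
    & forall c x, V x -> V (iota c * x)].

(** [X] is contained in the sum of [W] and the span of [s], in the style of
    [fin_gen]. *)
Definition spanned (W X : set S) (s : seq S) : Prop :=
  forall V, subspace V -> W `<=` V -> (forall x, x \in s -> V x) -> X `<=` V.

Definition finite_codim (W : set S) : Prop := exists s, spanned W setT s.

Lemma ideal_subspace A I : (forall c, A (iota c)) -> is_ideal A I -> subspace I.
Proof.
move=> kA hI; split; [exact: ideal0 hI|exact: (idealD hI)|].
by move=> c x; exact: (idealM hI).
Qed.

Lemma subspaceB V x y : subspace V -> V x -> V y -> V (x - y).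
Proof.
move=> [_ VD VZ] Vx Vy; apply: VD => //; rewrite -mulN1r -(rmorph1 iota) -rmorphN.
exact: VZ.
Qed.

Lemma subspace_mulr V a : subspace V -> subspace [set c | V (c * a)].
Proof.
move=> [V0 VD VZ]; split=> /=; first by rewrite mul0r.
  by move=> x y Vx Vy; rewrite mulrDl; exact: VD.
by move=> c x Vx; rewrite -mulrA; exact: VZ.
Qed.

(** Noetherian induction. If [I] is prime, it is maximal and has codimension
    one. If [a * b] is in [I] with [a] and [b] outside, then [I + (a)] and
    [I + (b)] have finite codimension, and the quotient of [I + (a)] by [I],
    being generated by [a] and killed by [b], is an image of [S / (I +
    (b))]. *)
Lemma finite_codim_dim0 I : noetherian (@setT S) ->
  (forall n s, maximal_ideal setT n -> exists c, n (s - iota c)) ->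
  is_ideal setT I ->
  (forall p, prime_ideal setT p -> I `<=` p -> maximal_ideal setT p) ->
  finite_codim I.
Proof.
move=> nS residue; move: I.
apply: (noetherian_ind (P := fun I =>
  (forall p, prime_ideal setT p -> I `<=` p -> maximal_ideal setT p) ->
  finite_codim I) sS nS) => // I hI IH Imax.
have [I1|nI1] := pselect (I 1).
  exists [::] => V _ IV _ x _; apply: IV; rewrite -[x]mulr1; exact: (idealM hI).
have [pI|npI] := pselect (prime_ideal setT I).
  exists [:: 1] => V sV IV V1 x _.
  have [c Ix] := residue _ x (Imax _ pI (@subset_refl _ I)).
  have [_ VD VZ] := sV; rewrite -(subrK (iota c) x); apply: VD; first exact: IV.
  by rewrite -[iota c]mulr1; apply: VZ; apply: V1; rewrite inE.
have [a [b [Iab nIa nIb]]] : exists a b, [/\ I (a * b), ~ I a & ~ I b].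
  apply: contrapT => nab; apply: npI; split=> //.
    by apply/(ideal_properP sS hI).
  move=> a b _ _ Iab; apply: contrapT => /not_orP [nIa nIb].
  by apply: nab; exists a, b.
have fc c : ~ I c -> finite_codim (add_ideal setT I c).
  move=> nIc; have ac : is_ideal setT (add_ideal setT I c).
    exact: (add_ideal_ideal sS hI).
  have Iac : I `<=` add_ideal setT I c by exact: (sub_add_ideal sS).
  apply: IH => //.
    split=> // h; apply: nIc; apply: h; exact: mem_add_ideal.
  by move=> p pp Ip; apply: Imax => //; exact: subset_trans Iac Ip.
have [[s sa] [t tb]] := (fc _ nIa, fc _ nIb).
exists (s ++ [seq y * a | y <- t]) => V sV IV stV.
have [_ VD VZ] := sV.
apply: sa => //; last by move=> x xs; apply: stV; rewrite mem_cat xs.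
move=> _ [y [c [Iy _ ->]]]; apply: VD; first exact: IV.
apply: (tb _ (subspace_mulr a sV)) => //.
  move=> _ [z [d [Iz _ ->]]] /=; apply: IV; rewrite mulrDl.
  apply: (idealD hI); first exact: (idealMC hI).
  by rewrite -mulrA [b * a]mulrC; exact: (idealM hI).
move=> x xt; apply: (stV (x * a)).
by rewrite mem_cat (map_f (fun y => y * a) xt) orbT.
Qed.

Lemma spanned_coord W X s : subspace W -> spanned W X s ->
  forall x, X x -> exists (c : 'I_(size s) -> k), W (x - \sum_i iota (c i) * s`_i).
Proof.
move=> sW sp; have [W0 WD WZ] := sW.
apply: sp.
- split.
  + exists (fun=> 0); rewrite big1 ?subr0 // => i _; by rewrite rmorph0 mul0r.
  + move=> x y [c Wx] [d Wy]; exists (fun i => c i + d i).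
    under eq_bigr do rewrite rmorphD mulrDl.
    by rewrite big_split /= opprD addrACA; exact: WD.
  + move=> a x [c Wx]; exists (fun i => a * c i).
    under eq_bigr do rewrite rmorphM -mulrA.
    by rewrite -mulr_sumr -mulrBr; exact: WZ.
- move=> x Wx; exists (fun=> 0); rewrite big1 ?subr0 // => i _.
  by rewrite rmorph0 mul0r.
- move=> x xs; have lt_x : (index x s < size s)%N by rewrite index_mem.
  exists (fun i => (i == Ordinal lt_x)%:R).
  rewrite (bigD1 (Ordinal lt_x)) //= eqxx rmorph1 mul1r nth_index //.
  rewrite big1 ?addr0 ?subrr //.
  by move=> i /negbTE ->; rewrite rmorph0 mul0r.
Qed.

(** Take [a] in [q] outside [p]. Its powers are linearly dependent modulo
    [I], so a nonzero polynomial with coefficients in [k] maps [a] into [p].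
    Such a polynomial splits, hence [a] is congruent modulo [p] to a scalar;
    this scalar is in [q], so it is 0, and [a] is in [p]. *)
Lemma finite_codim_no_chain I p q : is_ideal setT I -> finite_codim I ->
  prime_ideal setT p -> prime_ideal setT q -> I `<=` p -> ~ p `<` q.
Proof.
move=> hI [s sp] [hp pT pM] [hq qT _] Ip [pq qp].
have [a [qa npa]] : exists a, q a /\ ~ p a.
  by apply: contrapT => na; apply: qp => x qx; apply: contrapT => npx; apply: na; exists x.
have coord := spanned_coord (ideal_subspace (A := setT) (fun=> Logic.I) hI) sp.
have /choice [c cP] : forall j : 'I_(size s).+1, exists c : 'I_(size s) -> k,
    I (a ^+ j - \sum_i iota (c i) * s`_i) by move=> j; exact: coord.
pose M : 'M[k]_((size s).+1, size s) := \matrix_(j, i) c j i.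
have [u uM u0] : exists2 u : 'rV[k]_(size s).+1, u *m M = 0 & u != 0.
  have : kermx M != 0.
    rewrite -mxrank_eq0 mxrank_ker -lt0n subn_gt0.
    by apply: leq_ltn_trans (rank_leq_col _) _.
  by move=> /rowV0Pn [u /sub_kermxP uM u0]; exists u.
pose f := \poly_(j < (size s).+1) u 0 (inord j).
have f0 : f != 0.
  apply: contra_neq u0 => f0; apply/rowP => j; rewrite mxE.
  by move/polyP/(_ j): f0; rewrite coef_poly ltn_ord coef0 inord_val.
have If : I (map_poly iota f).[a].
  have -> : (map_poly iota f).[a] = \sum_(j < (size s).+1) iota (u 0 j) *
      (a ^+ j - \sum_i iota (c j i) * s`_i).
    under eq_bigr do rewrite mulrBr.
    rewrite sumrB [X in _ - X](_ : _ = 0) ?subr0.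
      rewrite (@horner_coef_wide _ (size s).+1).
        by apply: eq_bigr => j _; rewrite coef_map coef_poly ltn_ord /= inord_val.
      apply: leq_trans (size_poly _ _); exact: size_poly.
    under eq_bigr do rewrite mulr_sumr.
    rewrite exchange_big big1 // => i _ /=.
    under eq_bigr do rewrite mulrA -rmorphM.
    rewrite -mulr_suml -rmorph_sum.
    move/matrixP/(_ 0 i): uM; rewrite !mxE => uM.
    by rewrite [X in iota X](_ : _ = 0) ?rmorph0 ?mul0r // -[RHS]uM;
       apply: eq_bigr => j _; rewrite mxE.
  by apply: (ideal_sum hI) => j; apply: (idealM hI) => //; exact: cP.
have [r Er] := closed_field_poly_normal f.
have prod_p : p (\prod_(z <- r) (a - iota z)).
  have : p (map_poly iota f).[a] by exact: Ip.
  rewrite Er map_polyZ hornerZ rmorph_prod horner_prod /= => plf.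
  under eq_bigr => z _.
    have -> : a - iota z = (map_poly iota ('X - z%:P)).[a].
      by rewrite rmorphB /= map_polyX map_polyC hornerD hornerN hornerX hornerC.
    over.
  have -> : \prod_(z <- r) (map_poly iota ('X - z%:P)).[a] =
      iota (lead_coef f)^-1 * (iota (lead_coef f) *
      \prod_(z <- r) (map_poly iota ('X - z%:P)).[a]).
    by rewrite mulrA -rmorphM mulVf ?lead_coef_eq0 // rmorph1 mul1r.
  exact: (idealM hp).
have q1 : ~ q 1 by apply/(ideal_properP sS hq).
have p1 : ~ p 1 by apply/(ideal_properP sS hp).
elim: r prod_p {Er} => [|z r IHr]; first by rewrite big_nil.
rewrite big_cons => /(pM _ _ Logic.I Logic.I) [paz|]; last exact: IHr.
have qz : q (iota z) by apply: (idealBr sS hq (pq _ paz)).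
have [z0|z0] := eqVneq z 0; first by apply: npa; move: paz; rewrite z0 rmorph0 subr0.
by apply: q1; rewrite -(rmorph1 iota) -(mulVf z0) rmorphM; apply: (idealM hq).
Qed.

(** A subspace of a finite dimensional space is finite dimensional, stated
    modulo [K]. By induction on [s], the elements of [I] that are in the
    span of the tail are generated modulo [K]; one more generator suffices
    for [I], as the coordinate along the head is a linear form. *)
Lemma spanned_sub K I s : subspace K -> subspace I -> K `<=` I ->
  spanned K I s -> exists t, (forall x, x \in t -> I x) /\ spanned K I t.
Proof.
move=> sK; elim: s I => [|y s IHs] I sI KI sp; first by exists [::].
pose span : set S := [set v | forall V, subspace V -> K `<=` V ->
  (forall x, x \in s -> V x) -> V v].
have sspan : subspace span.
  split.
  - by move=> V [].
  - by move=> a b sa sb V sV KV tV; have [_ VD _] := sV; apply: VD; [exact: sa|exact: sb].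
  - by move=> c a sa V sV KV tV; have [_ _ VZ] := sV; apply: VZ; exact: sa.
have [span0 spanD spanZ] := sspan.
have coord x : I x -> exists c, span (x - iota c * y).
  move=> Ix; apply: (sp [set x | exists c, span (x - iota c * y)]) => //.
  - split.
    + by exists 0; rewrite rmorph0 mul0r subr0.
    + move=> a b [c sa] [d sb]; exists (c + d).
      by rewrite rmorphD mulrDl opprD addrACA; exact: spanD.
    + move=> c a [d sa]; exists (c * d).
      by rewrite rmorphM -mulrA -mulrBr; exact: spanZ.
  - by move=> a Ka; exists 0; rewrite rmorph0 mul0r subr0 => V _ KV _; exact: KV.
  - move=> a; rewrite inE => /orP [/eqP ->|sa].
      by exists 1; rewrite rmorph1 mul1r subrr.
    by exists 0; rewrite rmorph0 mul0r subr0 => V _ _; apply.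
have [I0 ID IZ] := sI.
have sI' : subspace (I `&` span).
  split=> //; first by move=> a b [? ?] [? ?]; split; [exact: ID|exact: spanD].
  by move=> c a [? ?]; split; [exact: IZ|exact: spanZ].
have [| |t [tI tsp]] := IHs _ sI'.
- by move=> x Kx; split; [exact: KI|move=> V _ KV _; exact: KV].
- by move=> V sV KV tV x [_]; apply.
have [Isub|] := pselect (I `<=` span).
  exists t; split; first by move=> x /tI [].
  by move=> V sV KV tV x Ix; apply: tsp => //; split=> //; exact: Isub.
move=> /existsNP [v /not_implyP [Iv nv]].
have [d sd] := coord _ Iv.
have d0 : d != 0.
  by apply: contra_notN nv => /eqP d0; move: sd; rewrite d0 rmorph0 mul0r subr0.
exists (v :: t); split; first by move=> x; rewrite inE => /orP [/eqP ->|/tI []].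
move=> V sV KV tV x Ix; have [c sc] := coord _ Ix.
have [_ VD VZ] := sV.
have Vv : V (iota (c / d) * v) by apply: VZ; apply: tV; rewrite inE eqxx.
rewrite -(subrK (iota (c / d) * v) x); apply: VD => //.
apply: tsp => //; first by move=> z zt; apply: tV; rewrite inE zt orbT.
split; first by apply: subspaceB => //; exact: IZ.
have -> : x - iota (c / d) * v =
    (x - iota c * y) - iota (c / d) * (v - iota d * y).
  rewrite mulrBr [iota (c / d) * (iota d * y)]mulrA -rmorphM divfK //.
  by rewrite opprB addrA subrK.
by apply: (subspaceB sspan) => //; exact: spanZ.
Qed.

(** Let [I] be an ideal of [A], and [K] the largest ideal of [S] contained
    in [I]; it contains [J * I]. As [S] is noetherian, [K] is a finitely
    generated [S]-module, and so a finitely generated [A]-module because [S]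
    is finite over [A]. Likewise [S * I] is generated over [S] by finitely
    many elements of [I], so that [S * I / J * I], and with it [I / K], is
    finite dimensional over [k]. *)
Lemma noetherian_finite_codim (A J : set S) : noetherian (@setT S) ->
  is_subring A -> (forall c, A (iota c)) -> is_ideal setT J -> J `<=` A ->
  finite_codim J -> noetherian A.
Proof.
move=> nS sA kA hJ JA [e espan]; apply/(noetherianP sA) => I hI.
pose core (L : set S) : set S := [set m | forall t, L (t * m)].
have core_ideal L : is_ideal A L -> is_ideal setT (core L).
  move=> hL; split=> //.
  - by move=> t; rewrite mulr0; exact: ideal0 hL.
  - by move=> x y cx cy t; rewrite mulrDr; apply: (idealD hL).
  - by move=> a x _ cx t; rewrite mulrA.
have core_subset L : core L `<=` L by move=> x /(_ 1); rewrite mul1r.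
have sub_idA L : is_ideal A L -> subspace L by exact: ideal_subspace.
have sub_idS L : is_ideal setT L -> subspace L by exact: ideal_subspace.
(* An A-ideal that contains the multiples of z by the generators 1 :: e of the
   A-module S contains S * z; the generator 1 takes care of J * z. *)
have absorb L z : is_ideal A L -> (forall x, x \in 1 :: e -> L (x * z)) -> core L z.
  move=> hL Lz t.
  have Lz1 : L z by rewrite -[z]mul1r; apply: Lz; rewrite inE eqxx.
  apply: (espan _ (subspace_mulr z (sub_idA _ hL))) => //.
    by move=> j Jj; apply: (idealM hL) => //; exact: JA.
  by move=> x xe; apply: Lz; rewrite inE xe orbT.
pose K := core I.
have hK : is_ideal setT K := core_ideal _ hI.
have [z [zK zgen]] := (noetherianP sS).1 nS _ hK.
have [x [xI xgen]] := noetherian_gen sS nS (X := I) (fun _ _ => Logic.I).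
have Ispan : spanned K I [seq a * b | a <- e, b <- x].
  move=> V sV KV exV.
  have [_ VD _] := sV.
  (* V need not be an ideal; the elements all of whose multiples are in V form
     one, and it contains x. *)
  apply: subset_trans (xgen [set m | forall t, V (t * m)] _ _) _.
  - split=> //.
    + by move=> t; rewrite mulr0; case: sV.
    + by move=> a b Va Vb t; rewrite mulrDr; exact: VD.
    + by move=> a b _ Vb t; rewrite mulrA; exact: Vb.
  - move=> y yx t; apply: (espan _ (subspace_mulr y sV)) => //.
      move=> j Jj; apply: KV => u; rewrite mulrA; apply: (idealM hI).
        by apply: JA; exact: (idealM hJ).
      exact: xI.
    by move=> a ae; apply: exV; exact: (allpairs_f (fun a b => a * b)).
  - by move=> m /(_ 1); rewrite mul1r.
have [t [tI tsp]] :=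
  spanned_sub (sub_idS _ hK) (sub_idA _ hI) (core_subset I) Ispan.
exists (t ++ [seq a * b | a <- 1 :: e, b <- z]); split.
  move=> y; rewrite mem_cat => /orP [/tI //|/allpairsP [[a b] /= [_ bz ->]]].
  exact: zK.
move=> L hL Lgen; apply: tsp; first exact: sub_idA.
  apply: subset_trans (core_subset L); apply: zgen; first exact: core_ideal.
  move=> b bz; apply: absorb => // a ae; apply: Lgen.
  by rewrite mem_cat (allpairs_f (fun a b => a * b)) ?orbT.
by move=> y yt; apply: Lgen; rewrite mem_cat yt.
Qed.

End FiniteCodimension.

(** * Localizations in the fraction field *)

Section Localization.
Variables (S : idomainType) (A P : set S).
Hypotheses (hA : is_subring A) (hP : prime_ideal A P).

Let iP : is_ideal A P. Proof. by case: hP. Qed.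
Let P1 : ~ P 1. Proof. by case: hP => _ /(ideal_properP hA iP). Qed.

Lemma prime_mulN a b : A a -> A b -> ~ P a -> ~ P b -> ~ P (a * b).
Proof. by case: hP => _ _ PM Aa Ab na nb /(PM _ _ Aa Ab) []. Qed.

Lemma tofrac_neq0 b : ~ P b -> tofrac b != 0.
Proof.
by rewrite tofrac_eq0; apply: contra_not_neq => ->; exact: ideal0 iP.
Qed.

Lemma tofrac_loc a : A a -> localization A P (tofrac a).
Proof.
move=> Aa; exists a, 1; split=> //; first by case: hA.
by rewrite tofrac1 divr1.
Qed.

Lemma inv_loc b : A b -> ~ P b -> localization A P (tofrac b)^-1.
Proof.
move=> Ab nb; exists 1, b; split=> //; first by case: hA.
by rewrite tofrac1 mul1r.
Qed.

Lemma localization_subring : is_subring (localization A P).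
Proof.
split; first by rewrite -(tofrac1 S); apply: tofrac_loc; case: hA.
- move=> _ _ [a [b [Aa Ab nb ->]]] [c [d [Ac Ad nd ->]]].
  exists (a * d - c * b), (b * d); split.
  + by case: (hA) => _ AB AM; apply: AB; exact: AM.
  + exact: (subringM hA).
  + exact: prime_mulN.
  + by rewrite -mulNr addf_div ?tofrac_neq0 // tofracB !tofracM mulNr.
- move=> _ _ [a [b [Aa Ab nb ->]]] [c [d [Ac Ad nd ->]]].
  exists (a * c), (b * d); split;
    [exact: (subringM hA)|exact: (subringM hA)|exact: prime_mulN|].
  by rewrite mulf_div !tofracM.
Qed.

Lemma noetherian_localization : noetherian A -> noetherian (localization A P).
Proof.
move=> /(noetherianP hA) nA; apply/(noetherianP localization_subring) => I hI.
have hpre J : is_ideal (localization A P) J -> is_ideal A [set a | A a /\ J (tofrac a)].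
  move=> hJ; split.
  - by move=> x [].
  - by split; [exact: (subring0 hA)|rewrite tofrac0; exact: ideal0 hJ].
  - move=> x y [Ax Jx] [Ay Jy]; split; first exact: (subringD hA).
    by rewrite tofracD; exact: (idealD hJ).
  - move=> a x Aa [Ax Jx]; split; first exact: (subringM hA).
    by rewrite tofracM; apply: (idealM hJ) => //; exact: tofrac_loc.
have [s [sI sgen]] := nA _ (hpre _ hI).
exists [seq tofrac a | a <- s]; split; first by move=> _ /mapP [a /sI [_ Ia] ->].
move=> J hJ sJ x Ix; have [a [b [Aa Ab nb Ex]]] := idealS hI Ix.
have Ia : I (tofrac a).
  have -> : tofrac a = tofrac b * x by rewrite Ex mulrC divfK ?tofrac_neq0.
  by apply: (idealM hI) => //; exact: tofrac_loc.
have [_ Ja] : [set a | A a /\ J (tofrac a)] a.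
  apply: (sgen _ (hpre _ hJ)) => // y ys; have [Ay _] := sI _ ys.
  by split=> //; apply: sJ; exact: map_f.
by rewrite Ex mulrC; apply: (idealM hJ) => //; exact: inv_loc.
Qed.

End Localization.

(** * Points, vanishing ideals and contractions *)

Section Points.
Variable T : comNzRingType.

Lemma point_inj (A : set T) (x y : MaxSpec A) : sval x = sval y -> x = y.
Proof.
by case: x y => [x px] [y py] /= E; subst y; congr exist; exact: Prop_irrelevance.
Qed.

Lemma closed_point (A : set T) (m : MaxSpec A) : zariski_closed [set m].
Proof.
exists (sval m); case: (svalP m) => hm mA mmax; split=> //.
apply/seteqP; split=> [m' -> //|m' /= mm'].
have [hm' m'A _] := svalP m'.
by have [E|//] := mmax _ hm' mm'; exact: point_inj.
Qed.

Let sT := @subring_setT T.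

Lemma point_ideal (x : MaxSpec (@setT T)) : is_ideal setT (sval x).
Proof. by case: (svalP x). Qed.

Lemma point_prime (x : MaxSpec (@setT T)) : prime_ideal setT (sval x).
Proof. exact: maximal_prime (svalP x). Qed.

Lemma point1 (x : MaxSpec (@setT T)) : ~ sval x 1.
Proof. by case: (point_prime x) => /(ideal_properP sT) h /h. Qed.

Lemma point_mul (x : MaxSpec (@setT T)) a b :
  ~ sval x a -> ~ sval x b -> ~ sval x (a * b).
Proof. by case: (point_prime x) => _ _ h na nb /(h _ _ Logic.I Logic.I) []. Qed.

Lemma point_subset (x y : MaxSpec (@setT T)) : sval x `<=` sval y -> x = y.
Proof.
move=> xy; apply: point_inj; have [_ _ xmax] := svalP x.
have [->//|E] := xmax _ (point_ideal y) xy.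
by case: (@point1 y); rewrite E.
Qed.

Lemma vanishing_sub (Y : set (MaxSpec (@setT T))) x :
  Y x -> vanishing_ideal Y `<=` sval x.
Proof. by move=> Yx f; apply. Qed.

Lemma vanishing_mem (Y : set (MaxSpec (@setT T))) x :
  zariski_closed Y -> vanishing_ideal Y `<=` sval x -> Y x.
Proof.
move=> [E [hE ->]] /= IE; apply: subset_trans IE => f Ef y /=; exact.
Qed.

Lemma vanishing_nonempty (Y : set (MaxSpec (@setT T))) :
  vanishing_ideal Y <> setT -> exists x, Y x.
Proof.
move=> Yproper; apply: contrapT => nY; apply: Yproper.
apply/seteqP; split=> // f _ x Yx.
by case: nY; exists x.
Qed.

(** A maximal ideal containing both [E] and the ideal of [Y] would be a zero
    of [E] on [Y]. *)
Lemma comaximal (Y : set (MaxSpec (@setT T))) (E : set T) :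
  noetherian (@setT T) -> zariski_closed Y -> is_ideal setT E ->
  (forall x, Y x -> ~ E `<=` sval x) ->
  exists e, E e /\ vanishing_ideal Y (1 - e).
Proof.
move=> nT cY hE nE; have hI := vanishing_ideal_is_ideal Y.
pose K : set T := [set x | exists e, E e /\ vanishing_ideal Y (x - e)].
have hK : is_ideal setT K.
  split=> //.
  - by exists 0; split; [exact: ideal0 hE|rewrite subrr; exact: ideal0 hI].
  - move=> a b [e [Ee Ia]] [f [Ef Ib]]; exists (e + f); split; first exact: (idealD hE).
    by rewrite opprD addrACA; exact: (idealD hI).
  - move=> a b _ [e [Ee Ib]]; exists (a * e); split; first exact: (idealM hE).
    by rewrite -mulrBr; exact: (idealM hI).
apply: contrapT => nK1.
have [|m mm Km] := ex_maximal sT nT hK.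
  by apply/(ideal_properP sT hK) => K1; apply: nK1.
pose x : MaxSpec (@setT T) := exist _ m mm.
apply: (nE x).
  apply: vanishing_mem => // f If; apply: Km; exists 0.
  by split; [exact: ideal0 hE|rewrite subr0].
by move=> e Ee; apply: Km; exists e; split=> //; rewrite subrr; exact: ideal0 hI.
Qed.

End Points.

Section ScalarsPlus.
Variables (k : fieldType) (S : comNzRingType) (iota : {rmorphism k -> S}).
Variable I : set S.
Hypothesis hI : is_ideal setT I.

Lemma scalars_plusP s : scalars_plus iota I s <-> exists c, I (s - iota c).
Proof.
split=> [[c [a [Ia ->]]]|[c Is]]; first by exists c; rewrite addrC addKr.
by exists c, (s - iota c); rewrite addrCA subrr addr0.
Qed.

Lemma scalars_plus_subring : is_subring (scalars_plus iota I).
Proof.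
split.
- by apply/scalars_plusP; exists 1; rewrite rmorph1 subrr; exact: ideal0 hI.
- move=> x y /scalars_plusP [c Ix] /scalars_plusP [d Iy]; apply/scalars_plusP.
  exists (c - d); have -> : x - y - iota (c - d) = (x - iota c) - (y - iota d) by ring.
  exact: (idealB (@subring_setT S) hI).
- move=> x y /scalars_plusP [c Ix] /scalars_plusP [d Iy]; apply/scalars_plusP.
  exists (c * d).
  have -> : x * y - iota (c * d) = x * (y - iota d) + iota d * (x - iota c) by ring.
  by apply: (idealD hI); exact: (idealM hI).
Qed.

Lemma scalars_plus_scalar c : scalars_plus iota I (iota c).
Proof. by apply/scalars_plusP; exists c; rewrite subrr; exact: ideal0 hI. Qed.

Lemma scalars_plus_ideal : I `<=` scalars_plus iota I.
Proof. by move=> x Ix; apply/scalars_plusP; exists 0; rewrite rmorph0 subr0. Qed.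

End ScalarsPlus.

Section Contraction.
Variables (k : fieldType) (S : comNzRingType) (iota : {rmorphism k -> S}).
Variables (R : set S).
Hypotheses (sR : is_subring R) (kR : forall c, R (iota c)).

Lemma contract_ideal I : is_ideal setT I -> is_ideal R (I `&` R).
Proof.
move=> hI; split.
- by move=> x [].
- by split; [exact: ideal0 hI|exact: (subring0 sR)].
- by move=> x y [? ?] [? ?]; split; [exact: (idealD hI)|exact: (subringD sR)].
- by move=> a x ? [? ?]; split; [exact: (idealM hI)|exact: (subringM sR)].
Qed.

Lemma contract_prime q : prime_ideal setT q -> prime_ideal R (q `&` R).
Proof.
move=> [hq /(ideal_properP (@subring_setT S) hq) q1 qM].
have h := contract_ideal hq.
split=> //; first by apply/(ideal_properP sR h) => -[].
by move=> a b Ra Rb [/(qM _ _ Logic.I Logic.I) [?|?] _]; [left|right].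
Qed.

Lemma contract_maximal m : maximal_ideal setT m ->
  (forall s, exists c, m (s - iota c)) -> maximal_ideal R (m `&` R).
Proof.
move=> [hm /(ideal_properP (@subring_setT S) hm) m1 _] residue.
apply: (scalar_residue_maximal sR kR); first exact: contract_ideal.
  by case.
move=> s Rs; have [c mc] := residue s; exists c; split=> //.
by case: sR => _ RB _; exact: RB.
Qed.

(** Inverting [f] makes [R] and [S] equal, so the prime of [S] above [p] is
    the set of [s] with [s * f] in [p]. *)
Lemma conductor_lift (p : set S) f : prime_ideal R p -> ~ p f ->
  (forall t, R (t * f)) -> exists q, prime_ideal setT q /\ q `&` R = p.
Proof.
move=> [hp /(ideal_properP sR hp) p1 pM] pf fR.
have Rf : R f by rewrite -[f]mul1r.
pose q : set S := [set s | p (s * f)].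
have hq : is_ideal setT q.
  split=> //=.
  - by rewrite /q /= mul0r; exact: ideal0 hp.
  - by move=> x y qx qy; rewrite /q /= mulrDl; exact: (idealD hp).
  - move=> a x _ qx; have : p (a * x * f * f).
      have -> : a * x * f * f = (x * f) * (a * f) by ring.
      exact: (idealMC hp).
    by move=> /(pM _ _ (fR _) Rf) [].
exists q; split.
  split=> //.
    by apply/(ideal_properP (@subring_setT S) hq); rewrite /q /= mul1r.
  move=> a b _ _ qab; apply: pM => //.
  have -> : a * f * (b * f) = a * b * f * f by rewrite mulrACA mulrA.
  exact: (idealMC hp).
apply/seteqP; split=> [s [qs Rs]|s ps]; first by have [] := pM _ _ Rs Rf qs.
split; last exact: (idealS hp).
exact: (idealMC hp).
Qed.

End Contraction.

(** * The glued ring *)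

Section Gluing.
Variables (k : closedFieldType) (S : idomainType) (iota : {rmorphism k -> S}).
Hypothesis hS : finitely_generated_algebra iota.
Variables (n : nat) (Y : 'I_n -> set (MaxSpec (@setT S))).
Hypothesis hclosed : forall i, zariski_closed (Y i).
Hypothesis hdisj : forall i j, i <> j -> Y i `&` Y j = set0.

Let sS := @subring_setT S.
Let nS : noetherian (@setT S) := affine_noetherian hS.
Let I i : set S := vanishing_ideal (Y i).
Let hI i : is_ideal setT (I i) := vanishing_ideal_is_ideal (Y i).

Definition glued : set S :=
  \bigcap_(i in @setT 'I_n) scalars_plus iota (vanishing_ideal (Y i)).

(** As soon as no [I i] is maximal, this is the largest ideal of [S]
    contained in [glued]: a nonzero ideal of [S / I i] consisting of scalars
    contains 1, so that [S / I i] is [k]. *)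
Definition conductor : set S := [set s | forall i, vanishing_ideal (Y i) s].

Lemma gluedP s : glued s <-> forall i, exists c, I i (s - iota c).
Proof.
split=> [Rs i|h i _]; last by apply/scalars_plusP; exact: h.
by apply/scalars_plusP; exact: Rs.
Qed.

Lemma glued_subring : is_subring glued.
Proof.
split.
- by move=> i _; case: (scalars_plus_subring iota (hI i)).
- move=> x y Rx Ry i _; case: (scalars_plus_subring iota (hI i)) => _ RB _.
  by apply: RB; [exact: Rx|exact: Ry].
- move=> x y Rx Ry i _; case: (scalars_plus_subring iota (hI i)) => _ _ RM.
  by apply: RM; [exact: Rx|exact: Ry].
Qed.
Let sR := glued_subring.

Lemma glued_scalar c : glued (iota c).
Proof. by move=> i _; exact: (scalars_plus_scalar iota (hI i)). Qed.

Lemma conductor_ideal : is_ideal setT conductor.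
Proof.
split=> //.
- by move=> i; exact: ideal0 (hI i).
- by move=> x y Jx Jy i; apply: (idealD (hI i)); [exact: Jx|exact: Jy].
- by move=> a x _ Jx i; apply: (idealM (hI i)) => //; exact: Jx.
Qed.

Lemma conductor_glued : conductor `<=` glued.
Proof. by move=> s Js i _; apply: scalars_plus_ideal; exact: Js. Qed.

Lemma residue (x : MaxSpec (@setT S)) s : exists c, sval x (s - iota c).
Proof. exact: (residue_field hS s (svalP x)). Qed.

Lemma glued_value i x s : Y i x -> glued s -> sval x s <-> I i s.
Proof.
move=> Yx /gluedP /(_ i) [c Ic]; split; last by apply: vanishing_sub.
move=> xs; suff c0 : c = 0 by move: Ic; rewrite c0 rmorph0 subr0.
have xc : sval x (iota c).
  by apply: (idealBr sS (point_ideal x) _ xs); exact: vanishing_sub Ic.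
apply: contrapT => /eqP c0; apply: (@point1 _ x).
by rewrite -(rmorph1 iota) -(mulVf c0) rmorphM; apply: (idealM (point_ideal x)).
Qed.

(** [e] is the product over [j] of elements equal to 1 on [Y i] and to 0 on
    [Y j], which exist because [Y i] and [Y j] are disjoint. *)
Lemma partition_of_unity i : exists e, I i (1 - e) /\ forall j, j <> i -> I j e.
Proof.
have /choice [a aP] : forall j, exists a, j <> i -> I i (1 - a) /\ I j a.
  move=> j; have [->|ji] := pselect (j = i); first by exists 0.
  have [|e [Je Ie]] := comaximal (E := I j) nS (hclosed i) (hI j).
    move=> x Yix /(vanishing_mem (hclosed j)) Yjx.
    by have : (Y i `&` Y j) x by []; rewrite hdisj //; exact: nesym.
  by exists e.
exists (\prod_(j | j != i) a j); split.
  elim/big_ind: _ => [|x y Ix Iy|j /eqP /aP [] //].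
    by rewrite subrr; exact: ideal0 (hI i).
  have -> : 1 - x * y = (1 - x) + x * (1 - y) by ring.
  by apply: (idealD (hI i)) => //; exact: (idealM (hI i)).
move=> j ji; rewrite (bigD1 j) /=; last exact/eqP.
by apply: (idealMC (hI j)) => //; have [] := aP j ji.
Qed.

Lemma unity_mul_glued i e s : I i (1 - e) -> (forall j, j <> i -> I j e) ->
  scalars_plus iota (I i) s -> glued (s * e).
Proof.
move=> Ie Je /scalars_plusP [c Is]; apply/gluedP => j.
have [->|ji] := pselect (j = i).
  exists c; have -> : s * e - iota c = (s - iota c) - s * (1 - e) by ring.
  by apply: (idealB sS (hI i)) => //; exact: (idealM (hI i)).
exists 0; rewrite rmorph0 subr0; apply: (idealM (hI j)) => //; exact: Je.
Qed.

Lemma conductor_avoid x : (forall i, ~ Y i x) -> exists f, conductor f /\ ~ sval x f.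
Proof.
move=> nY; have /choice [f fP] : forall i, exists f, I i f /\ ~ sval x f.
  move=> i; apply: contrapT => nf; apply: (nY i); apply: vanishing_mem => // f If.
  by apply: contrapT => nxf; apply: nf; exists f.
exists (\prod_i f i); split.
  move=> i; rewrite (bigD1 i) //=; apply: (idealMC (hI i)) => //.
  by have [] := fP i.
elim/big_ind: _ => [|a b|i _]; [exact: point1|exact: point_mul|by have [] := fP i].
Qed.

Lemma glue_maximal (x : MaxSpec (@setT S)) : maximal_ideal glued (sval x `&` glued).
Proof. exact: (contract_maximal sR glued_scalar (svalP x) (residue x)). Qed.

Definition glue (x : MaxSpec (@setT S)) : MaxSpec glued := exist _ _ (glue_maximal x).

(** A prime [p] that does not contain the conductor lifts by
    [conductor_lift]. If it does, it contains the product of the ideals [I i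
    `&` glued], hence one of them; this one is maximal, so [p] is the image
    of any point of [Y i]. *)
Lemma glued_prime_lift p : (forall i, I i <> setT) -> prime_ideal glued p ->
  exists q, prime_ideal setT q /\ q `&` glued = p.
Proof.
move=> Iproper pp; have [hp pR pM] := pp.
have [[f [Jf pf]]|nf] := pselect (exists f, conductor f /\ ~ p f).
  apply: (conductor_lift sR pp pf) => t; apply: conductor_glued.
  exact: (idealM conductor_ideal).
have Jp : conductor `<=` p.
  by move=> f Jf; apply: contrapT => npf; apply: nf; exists f.
have [i Ip] : exists i, I i `&` glued `<=` p.
  apply: contrapT => nI.
  have /choice [f fP] : forall i, exists f, [/\ I i f, glued f & ~ p f].
    move=> i; apply: contrapT => nfi; apply: nI; exists i => f [If Rf].
    by apply: contrapT => npf; apply: nfi; exists f.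
  have p1 : ~ p 1 by apply/(ideal_properP sR hp).
  have [_ npf] : glued (\prod_i f i) /\ ~ p (\prod_i f i).
    elim/big_ind: _ => [|a b [Ra na] [Rb nb]|i _]; last by have [] := fP i.
      by split=> //; case: sR.
    by split; [exact: (subringM sR)|move=> /(pM _ _ Ra Rb) []].
  apply: npf; apply: Jp => i; rewrite (bigD1 i) //=.
  by apply: (idealMC (hI i)) => //; have [] := fP i.
have [x Yx] := vanishing_nonempty (Iproper i).
exists (sval x); split; first exact: point_prime.
have [_ _ xmax] := glue_maximal x.
have [|//|E] := xmax _ hp; last by case: pR.
by move=> s [xs Rs]; apply: Ip; split=> //; apply/(glued_value Yx Rs).
Qed.

(** A prime of [S] above [m] exists, and a maximal ideal containing this
    prime has the same contraction, by maximality of [m]. *)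
Lemma glue_surj (m : MaxSpec glued) : (forall i, I i <> setT) ->
  exists x, glue x = m.
Proof.
move=> Iproper; have mm := svalP m; have pm := maximal_prime sR mm.
have [q [[hq qT _] Eq]] := glued_prime_lift Iproper pm.
have [x mx qx] := ex_maximal sS nS hq qT.
exists (exist _ x mx); apply: point_inj => /=.
have hx := glue_maximal (exist _ x mx).
have [_ _ mmax] := mm; have [hxR xR _] := hx.
have [|//|E] := mmax _ hxR; last by case: xR.
by rewrite -Eq => s [qs Rs]; split=> //; exact: qx.
Qed.

(** With [f] in the conductor and nonzero at [x], a function [s] vanishing
    at [x'] gives the element [s * f] of [glued], so [s] vanishes at [x] as
    well. *)
Lemma glue_inj_off x x' : (forall i, ~ Y i x) -> glue x = glue x' -> x = x'.
Proof.
move=> nY /(congr1 sval) /= E; have [f [Jf nxf]] := conductor_avoid nY.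
symmetry; apply: point_subset => s xs.
have Rsf : glued (s * f) by apply/conductor_glued/(idealM conductor_ideal).
have : (sval x' `&` glued) (s * f) by split=> //; exact: (idealMC (point_ideal x')).
rewrite -E => -[xsf _]; apply: contrapT => nxs.
exact: (point_mul nxs nxf).
Qed.

Lemma glue_on i x x' : Y i x -> Y i x' -> glue x = glue x'.
Proof.
move=> Yx Yx'; apply: point_inj => /=; apply/seteqP.
by split=> s [xs Rs]; split=> //;
  [apply/(glued_value Yx' Rs)/(glued_value Yx Rs)
  |apply/(glued_value Yx Rs)/(glued_value Yx' Rs)].
Qed.

Lemma glue_distinct i j x x' : Y i x -> Y j x' -> glue x = glue x' -> i = j.
Proof.
move=> Yx Yx' /(congr1 sval) /= E; apply: contrapT => ij.
have [e [Ie Je]] := partition_of_unity i.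
have Re : glued e.
  rewrite -[e]mul1r; apply: unity_mul_glued Ie Je _.
  by case: (scalars_plus_subring iota (hI i)).
have : (sval x' `&` glued) e.
  by split=> //; apply: (vanishing_sub Yx'); apply: Je; exact: nesym.
rewrite -E => -[xe _]; apply: (@point1 _ x).
by apply: (idealBl (point_ideal x) _ xe); exact: vanishing_sub Ie.
Qed.

Lemma glue_eq x x' : glue x = glue x' <-> x = x' \/ exists i, Y i x /\ Y i x'.
Proof.
split=> [E|[->//|[i [Yx Yx']]]]; last exact: glue_on Yx Yx'.
have [[i Yx]|nY] := pselect (exists i, Y i x); last first.
  by left; apply: glue_inj_off E => i Yx; apply: nY; exists i.
have [[j Yx']|nY'] := pselect (exists j, Y j x'); last first.
  by left; apply/esym/glue_inj_off => // j Yx'; apply: nY'; exists j.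
by right; exists i; split=> //; rewrite (glue_distinct Yx Yx' E).
Qed.

(** If the preimage of [Z] is the zero set of the ideal [E] of [S], then [Z]
    is the zero set of [E `&` glued]. The point is that a zero [x] of [E `&`
    glued] can be moved inside its fiber to a zero of [E]. Off the [Y i],
    multiply by an element of the conductor. If [x] is on [Y i] and [E] has
    no zero there, some [g] in [E] equals 1 on [Y i], and multiplying it by
    a function equal to 1 on [Y i] and 0 on the other [Y j] gives an element
    of [E `&` glued] which is 1 at [x]. *)
Lemma glue_topology (Z : set (MaxSpec glued)) : (forall i, I i <> setT) ->
  zariski_closed Z <-> zariski_closed (glue @^-1` Z).
Proof.
move=> Iproper; split=> -[E [hE EZ]].
  exists [set s | forall x, (glue @^-1` Z) x -> sval x s]; split.
    exact: vanishing_ideal_is_ideal.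
  apply/seteqP; split=> [x Zx s|x Ex]; first by apply.
  rewrite EZ /= => s Es; split; last exact: (idealS hE).
  by apply: Ex => y; rewrite EZ /= => /(_ _ Es) [].
have hER := contract_ideal sR hE.
exists (E `&` glued); split=> //.
apply/seteqP; split=> m; have [x <-] := glue_surj m Iproper.
  move=> Zx s [Es Rs] /=; split=> //.
  by have : (glue @^-1` Z) x by []; rewrite EZ; apply.
move=> /= ERx.
suff [x' [Ex' <-]] : exists x', E `<=` sval x' /\ glue x' = glue x.
  by have : (glue @^-1` Z) x' by rewrite EZ.
have [[i Yx]|nY] := pselect (exists i, Y i x).
  apply: contrapT => nx'.
  have [|g [Eg Ig]] := comaximal (Y := Y i) nS (hclosed i) hE.
    by move=> x' Yx' Ex'; apply: nx'; exists x'; split=> //; exact: glue_on Yx' Yx.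
  have [e [Ie Je]] := partition_of_unity i.
  have [xge _] : (sval x `&` glued) (g * e).
    apply: ERx; split; first exact: (idealMC hE).
    apply: unity_mul_glued Ie Je _; apply/scalars_plusP; exists 1.
    by rewrite rmorph1 -opprB; exact: (idealN sS (hI i)).
  apply: (@point1 _ x).
  have -> : 1 = g * e + ((1 - g) + g * (1 - e)) by ring.
  have hx := point_ideal x.
  apply: (idealD hx) => //; apply: (idealD hx); first exact: vanishing_sub Ig.
  by apply: (idealM hx) => //; exact: vanishing_sub Ie.
exists x; split=> // s Es.
have [|f [Jf nxf]] := conductor_avoid (x := x).
  by move=> i Yx; apply: nY; exists i.
apply: contrapT => nxs; apply: (point_mul nxs nxf).
suff [] : (sval x `&` glued) (s * f) by [].
apply: ERx; split; first exact: (idealMC hE).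
by apply: conductor_glued; exact: (idealM conductor_ideal).
Qed.

Lemma glue_prime (x : MaxSpec (@setT S)) : prime_ideal glued (sval x `&` glued).
Proof. exact: maximal_prime (glue_maximal x). Qed.

Lemma localization_off x : (forall i, ~ Y i x) ->
  localization glued (sval x `&` glued) = localization setT (sval x).
Proof.
move=> nY; have [f [Jf nxf]] := conductor_avoid nY.
have Rf t : glued (t * f) by apply/conductor_glued/(idealM conductor_ideal).
apply/seteqP; split=> _ [a [b [Ra Rb nb ->]]].
  by exists a, b; split=> // xb; apply: nb.
exists (a * f), (b * f); split=> //; first by case=> + _; exact: point_mul.
have f0 := tofrac_neq0 (point_prime x) nxf.
by rewrite !tofracM -mulf_div divff // mulr1.
Qed.

(** As [I i] is not maximal, [Y i] has a second point [x']. If [s] vanishes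
    at [x'] but not at [x], then [1 / s] is in the local ring of [S] at [x].
    Writing it as [a / b] with [a] and [b] in [glued], the function [b = a *
    s] vanishes at [x'], hence at [x], as it is constant on [Y i]. *)
Lemma localization_on i x : (forall i, ~ maximal_ideal setT (I i)) -> Y i x ->
  localization glued (sval x `&` glued) <> localization setT (sval x).
Proof.
move=> Inonmax Yx E.
have [x' [Yx' xx']] : exists x', Y i x' /\ x' <> x.
  apply: contrapT => nx'; apply: (Inonmax i).
  suff -> : I i = sval x by exact: svalP x.
  apply/seteqP; split; first exact: vanishing_sub.
  move=> s xs y Yy; have [->//|yx] := pselect (y = x).
  by case: nx'; exists y.
have [s [x's nxs]] : exists s, sval x' s /\ ~ sval x s.
  apply: contrapT => ns; apply: xx'; apply: point_subset => s x's.
  by apply: contrapT => nxs; apply: ns; exists s.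
have s0 := tofrac_neq0 (point_prime x) nxs.
have : localization setT (sval x) (tofrac s)^-1 by exact: inv_loc.
rewrite -E => -[a [b [Ra Rb nb Eab]]].
have b0 := tofrac_neq0 (glue_prime x) nb.
have Eb : b = a * s.
  apply/eqP; rewrite -tofrac_eq tofracM -(mulfVK b0 (tofrac a)) -Eab.
  by rewrite mulrAC mulVf // mul1r.
apply: nb; split=> //; apply/(glued_value Yx Rb)/(glued_value Yx' Rb).
by rewrite Eb; exact: (idealM (point_ideal x')).
Qed.

Lemma U_locus_glued : (forall i, ~ maximal_ideal setT (I i)) ->
  U_locus glued = \bigcap_(i in @setT 'I_n) ~` Y i.
Proof.
move=> Inonmax; apply/seteqP; split=> [x Ux i _ Yx|x nY].
  exact: (localization_on Inonmax Yx).
by apply: localization_off => i; exact: nY.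
Qed.

Lemma conductor_neq0 : (forall i, I i <> [set 0]) -> exists f, conductor f /\ f != 0.
Proof.
move=> I0; have /choice [f fP] : forall i, exists f, I i f /\ f != 0.
  move=> i; apply: contrapT => nf; apply: (I0 i); apply/seteqP; split=> [f If|f ->].
    by apply/eqP; apply: contrapT => /negP f0; apply: nf; exists f.
  exact: ideal0 (hI i).
exists (\prod_i f i); split.
  move=> i; rewrite (bigD1 i) //=; apply: (idealMC (hI i)) => //.
  by have [] := fP i.
by apply/prodf_neq0 => i _; have [] := fP i.
Qed.

(** Let [f] be a nonzero element of the conductor. The fractions [s * f /
    b], with [s] in [S], form an ideal of the local ring, and so do those
    with [s] in a subspace [V] containing [I i], because [glued] acts on [S
    / I i] through scalars. If the numerators of finitely many generators
    are in [V], then the two ideals coincide; clearing denominators, which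
    are nonzero scalars modulo [I i], gives that [V] is [S]. *)
Lemma noetherian_point i x : (forall i, I i <> [set 0]) -> Y i x ->
  noetherian (localization glued (sval x `&` glued)) -> finite_codim iota (I i).
Proof.
move=> I0 Yx; have [f [Jf f0]] := conductor_neq0 I0.
have sL := localization_subring sR (glue_prime x).
have F0 : tofrac f != 0 by rewrite tofrac_eq0.
have Rf t : glued (t * f) by apply/conductor_glued/(idealM conductor_ideal).
set L := localization _ _ in sL *.
pose frac (W : set S) : set {fraction S} := [set z | exists s b,
  [/\ W s, glued b, ~ (sval x `&` glued) b & z = tofrac (s * f) / tofrac b]].
have hfrac W : W 0 -> (forall s t, W s -> W t -> W (s + t)) ->
    (forall r s, glued r -> W s -> W (r * s)) -> is_ideal L (frac W).
  move=> W0 WD WM; split.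
  - by move=> _ [s [b [Ws Rb nb ->]]]; exists (s * f), b.
  - exists 0, 1; split=> //; first by case: sR.
      by case=> /point1.
    by rewrite mul0r tofrac0 mul0r.
  - move=> _ _ [s [b [Ws Rb nb ->]]] [t [c [Wt Rc nc ->]]].
    exists (c * s + b * t), (b * c); split.
    + by apply: WD; exact: WM.
    + exact: (subringM sR).
    + exact: (prime_mulN (glue_prime x)).
    + rewrite addf_div ?(tofrac_neq0 (glue_prime x)) // -!tofracM -tofracD.
      by congr (tofrac _ / _); ring.
  - move=> _ _ [a [b [Ra Rb nb ->]]] [t [c [Wt Rc nc ->]]].
    exists (a * t), (b * c); split.
    + exact: WM.
    + exact: (subringM sR).
    + exact: (prime_mulN (glue_prime x)).
    + by rewrite mulf_div -!tofracM mulrA.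
move=> /(noetherianP sL) nL.
have [|g [gK ggen]] := nL (frac setT); first by apply: hfrac.
have [t tP] : exists t : seq S, forall z, z \in g -> exists s b,
    [/\ s \in t, glued b, ~ (sval x `&` glued) b & z = tofrac (s * f) / tofrac b].
  elim: g gK {ggen} => [|z g IHg] gK; first by exists [::].
  have [|t tP] := IHg; first by move=> y yg; apply: gK; rewrite inE yg orbT.
  have [|s [b [_ Rb nb Ez]]] := gK z; first by rewrite inE eqxx.
  exists (s :: t) => y; rewrite inE => /orP [/eqP ->|/tP [s' [b' [s't ? ? ?]]]].
    by exists s, b; rewrite inE eqxx.
  by exists s', b'; rewrite inE s't orbT.
exists t => V sV IV tV u _; have [V0 VD VZ] := sV.
have Vmul r s : glued r -> V s -> V (r * s).
  move=> /gluedP /(_ i) [c Ic] Vs; rewrite -(subrK (iota c) r) mulrDl.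
  by apply: VD; [apply/IV/(idealMC (hI i))|exact: VZ].
have : frac V (tofrac (u * f) / tofrac 1).
  apply: (ggen _ (hfrac _ V0 VD Vmul)).
    by move=> z /tP [s [b [st Rb nb ->]]]; exists s, b; split=> //; exact: tV.
  by exists u, 1; split=> //; [case: sR|case=> /point1].
move=> [s [b [Vs Rb nb]]].
have b0 := tofrac_neq0 (glue_prime x) nb.
rewrite tofrac1 divr1 => Eu.
have Ebu : b * u = s.
  apply/eqP; rewrite -tofrac_eq -(inj_eq (mulIf F0)) -!tofracM -mulrA tofracM Eu.
  by rewrite mulrC divfK.
have /gluedP /(_ i) [c Ic] := Rb.
have c0 : c != 0.
  apply: contra_notN nb => /eqP c0; split=> //; apply: (vanishing_sub Yx).
  by move: Ic; rewrite c0 rmorph0 subr0.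
have Vcu : V (iota c * u).
  have -> : iota c * u = s - (b - iota c) * u by rewrite -Ebu; ring.
  by apply: (subspaceB sV) => //; apply/IV/(idealMC (hI i)).
by rewrite -[u]mul1r -(rmorph1 iota) -(mulVf c0) rmorphM -mulrA; exact: VZ.
Qed.

(** Multiplying numerator and denominator by a function equal to 1 on [Y i]
    and to 0 on the other [Y j] turns a fraction of [k + I i] into one of
    [glued]. *)
Lemma localization_one i x : Y i x ->
  localization glued (sval x `&` glued) =
  localization (scalars_plus iota (I i)) (sval x `&` scalars_plus iota (I i)).
Proof.
move=> Yx; have [e [Ie Je]] := partition_of_unity i.
have nxe : ~ sval x e.
  move=> xe; apply: (@point1 _ x).
  by apply: (idealBl (point_ideal x) _ xe); exact: vanishing_sub Ie.
have e0 := tofrac_neq0 (point_prime x) nxe.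
apply/seteqP; split=> _ [a [b [Ra Rb nb ->]]].
  exists a, b; split=> //; [exact: Ra|exact: Rb|].
  by case=> xb _; apply: nb.
exists (a * e), (b * e); split.
- exact: unity_mul_glued Ie Je Ra.
- exact: unity_mul_glued Ie Je Rb.
- by case=> + _; apply: point_mul => // xb; apply: nb.
- by rewrite !tofracM -mulf_div divff // mulr1.
Qed.

Lemma finite_codim_noetherian_point i x : Y i x -> finite_codim iota (I i) ->
  noetherian (localization glued (sval x `&` glued)).
Proof.
move=> Yx fI; rewrite (localization_one Yx).
have sRi := scalars_plus_subring iota (hI i).
apply: noetherian_localization => //.
  exact: (contract_prime sRi (point_prime x)).
apply: (noetherian_finite_codim nS sRi _ (hI i) _ fI).
  exact: scalars_plus_scalar.
exact: scalars_plus_ideal.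
Qed.

(** [S / conductor] is the product of the rings [S / I i], and the functions
    [e i] of [partition_of_unity] are its idempotents. *)
Lemma conductor_finite_codim : (forall i, finite_codim iota (I i)) ->
  finite_codim iota conductor.
Proof.
move=> /choice [s sP]; have /choice [e eP] := partition_of_unity.
exists (flatten [seq [seq t * e i | t <- s i] | i <- enum 'I_n]).
move=> V sV JV sVs u _; have [V0 VD VZ] := sV.
have Vi i v : V (v * e i).
  apply: (sP i _ (subspace_mulr (e i) sV)) => //.
    move=> w Iw; apply: JV => j; have [Ie Je] := eP i.
    have [->|ji] := pselect (j = i); first exact: (idealMC (hI i)).
    by apply: (idealM (hI j)) => //; exact: Je.
  move=> t ts; apply: sVs; apply/flattenP; exists [seq t * e i | t <- s i].
    by apply: map_f; rewrite mem_enum.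
  exact: (map_f (fun t => t * e i)).
have -> : u = (u - \sum_i u * e i) + \sum_i u * e i by rewrite subrK.
apply: (VD); last by elim/big_ind: _ => // a b; exact: VD.
apply: JV => j; have [Ie _] := eP j; rewrite (bigD1 j) //= opprD addrA.
apply: (idealB sS (hI j)).
  by rewrite -{1}[u]mulr1 -mulrBr; exact: (idealM (hI j)).
elim/big_ind: _ => [|a b|i /eqP ij].
- exact: ideal0 (hI j).
- exact: (idealD (hI j)).
by apply: (idealM (hI j)) => //; have [_] := eP i; apply; exact: nesym.
Qed.

Hypothesis hproper : forall i, vanishing_ideal (Y i) <> setT.

(** If there is no chain of two primes above [I i], these primes are all
    maximal, and [finite_codim_dim0] applies. *)
Lemma dim_geq1_codim i : dim_geq (@hproper i) 1 <-> ~ finite_codim iota (I i).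
Proof.
rewrite dim_geq1; split.
  by move=> [p [q [pp pq Ip pltq]]] /(finite_codim_no_chain (hI i))/(_ pp pq Ip); apply.
move=> nfin; apply: contrapT => nchain; apply: nfin.
apply: finite_codim_dim0 => //.
  by move=> m s mm; exact: (residue_field hS s mm).
move=> p pp Ip; apply: contrapT => npmax.
have [hp pT _] := pp.
have [m mm pm] := ex_maximal sS nS hp pT.
apply: nchain; exists p, m; split=> //; first exact: maximal_prime.
by split=> // mp; apply: npmax; have -> : p = m by apply/seteqP.
Qed.

Hypothesis hnonzero : forall i, vanishing_ideal (Y i) <> [set 0].
Hypothesis hnonmax : forall i, ~ maximal_ideal setT (vanishing_ideal (Y i)).

Lemma glued_nonnoetherian :
  ~ noetherian glued <-> exists i, dim_geq (@hproper i) 1.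
Proof.
split.
  move=> nR; apply: contrapT => nd; apply: nR.
  apply: (noetherian_finite_codim nS sR glued_scalar conductor_ideal conductor_glued).
  apply: conductor_finite_codim => i; apply: contrapT => nfin.
  by apply: nd; exists i; apply/dim_geq1_codim.
move=> [i /dim_geq1_codim nfin] nR; apply: nfin.
have [x Yx] := vanishing_nonempty (@hproper i).
apply: (noetherian_point hnonzero Yx).
by apply: noetherian_localization => //; exact: glue_prime.
Qed.

(** At a point of [Y i] the local ring of [glued] differs from that of [S],
    so depiction forces it to be nonnoetherian. Conversely, off the [Y i]
    the two local rings coincide and are noetherian; such points exist
    because a nonzero element of the conductor is nonzero at some point. *)
Lemma glued_depicted : depicts glued <-> forall i, dim_geq (@hproper i) 1.
Proof.
split=> [[_ EU _] i|dim].
  apply/dim_geq1_codim => fI; have [x Yx] := vanishing_nonempty (@hproper i).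
  have : U_locus glued x.
    by rewrite EU; exact: finite_codim_noetherian_point Yx fI.
  exact: (localization_on hnonmax Yx).
split.
- by move=> p; exact: glued_prime_lift.
- apply/seteqP; split=> x.
    move=> Ux; rewrite /= (Ux : localization _ _ = _).
    exact: noetherian_localization (point_prime x) nS.
  move=> nx; rewrite U_locus_glued // => i _ Yx.
  exact/(dim_geq1_codim i).1/(noetherian_point hnonzero Yx).
- have [f [Jf f0]] := conductor_neq0 hnonzero.
  have p0 : prime_ideal setT [set (0 : S)].
    have h0 : is_ideal setT [set (0 : S)].
      split=> //= [x y -> ->|a x _ ->]; [exact: addr0|exact: mulr0].
    split=> //; first by apply/(ideal_properP sS h0) => /eqP; rewrite oner_eq0.
    by move=> a b _ _ /= /eqP; rewrite mulf_eq0 => /orP [] /eqP; [left|right].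
  have [|m [mm _ nmf _]] := nullstellensatz hS (f := f) p0; first exact/eqP.
  exists (exist _ m mm); rewrite U_locus_glued // => i _ Ym.
  by apply: nmf; exact: (vanishing_sub Ym (Jf i)).
Qed.

End Gluing.

Theorem theoremA (k : closedFieldType) (S : idomainType)
    (iota : {rmorphism k -> S}) (hS : finitely_generated_algebra iota)
    (n : nat) (Y : 'I_n -> set (MaxSpec (@setT S)))
    (hclosed : forall i, zariski_closed (Y i))
    (hdisj : forall i j, i <> j -> Y i `&` Y j = set0)
    (hproper : forall i, vanishing_ideal (Y i) <> setT)
    (hnonzero : forall i, vanishing_ideal (Y i) <> [set 0])
    (hnonmax : forall i, ~ maximal_ideal setT (vanishing_ideal (Y i))) :
  let R : set S :=
    \bigcap_(i in @setT 'I_n) scalars_plus iota (vanishing_ideal (Y i)) in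
  [/\ exists (phi : MaxSpec (@setT S) -> MaxSpec R) (y : 'I_n -> MaxSpec R),
        [/\ forall x, sval (phi x) = sval x `&` R,
            forall m, exists x, phi x = m,
            forall x x', phi x = phi x' <->
              (x = x' \/ exists i, Y i x /\ Y i x'),
            (forall i j, y i = y j -> i = j) /\
              (forall i, phi @` Y i = [set y i] /\ zariski_closed [set y i])
          & forall Z : set (MaxSpec R),
              zariski_closed Z <-> zariski_closed (phi @^-1` Z)],
      U_locus R = \bigcap_(i in @setT 'I_n) ~` Y i,
      ~ noetherian R <-> exists i, dim_geq (hproper i) 1
    & depicts R <-> forall i, dim_geq (hproper i) 1].
Proof.
move=> R; split.
- have /choice [x xY] : forall i, exists x, Y i x.
    by move=> i; exact: vanishing_nonempty (hproper i).
  exists (glue hS Y), (fun i => glue hS Y (x i)); split.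
  + by [].
  + by move=> m; exact: glue_surj.
  + by move=> a b; exact: glue_eq.
  + split=> [i j|i]; first exact: (glue_distinct hclosed hdisj (xY i) (xY j)).
    split; last exact: closed_point.
    apply/seteqP; split=> [_ [a Ya <-]|_ ->]; first exact: (glue_on hS Ya).
    by exists (x i).
  + by move=> Z; exact: glue_topology.
- exact: U_locus_glued.
- exact: glued_nonnoetherian.
- exact: glued_depicted.
Qed.
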